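(* Let $(M,d,\mu_M)$ be a proper complete metric space with a positive Radon measure $\mu_M$ satisfying the volume growth assumption with constant $h_M>0$ and base point $o\in M$. Let $(\mathscr{H},\ge)$ be a Hilbert space over $\mathbb{R}$ equipped with a partial order compatible with the norm. Let $\Pi$ be a point process on $M$ satisfying the small variance assumption and with first intensity measure $\mu_M$. Fix a function $f\in\mathrm{CMVP}(\mu_M;\mathscr{H}_+)$ and a sequence $(s_n)_{n\ge1}$ in $(h_M,\infty)$ converging to $h_M$ and satisfying $$\sum_{n=1}^\infty\frac{\displaystyle\int_Me^{-2s_nd(x,o)}\|f(x)\|_{\mathscr{H}}^2\,d\mu_M(x)}{\displaystyle\Big[\int_Me^{-s_nd(x,o)}\,d\mu_M(x)\Big]^2}<\infty.$$ Then $\Pi$-almost every $X$ satisfies: (i) the series $\sum_{x\in X}e^{-sd(x,z)}f(x)$ converges unconditionally in $\mathscr{H}$ for all $s>h_M$ and all $z\in M$; (ii) the limit equality $$f(z)=\lim_{n\to\infty}\frac{\displaystyle\sum_{x\in X}e^{-s_nd(x,z)}f(x)}{\displaystyle\sum_{x\in X}e^{-s_nd(x,z)}}$$ holds in the norm topology of $\mathscr{H}$ for all $z\in M$.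
   Context: $B(z,r)$ denotes the ball $\{x: d(x,z)<r\}$. A non-negative function $\Lambda$ on $\mathbb{R}^+$ (or $\mathbb{N}$) is sub-exponential if $\lim_{t\to+\infty}\Lambda(t)e^{-\alpha t}=0$ for every $\alpha>0$. A pair $(L,U)$, $L\le U$, of continuous non-negative functions on $[0,\infty)$ is controllable if $\liminf_{r\to\infty}L(r)>0$ and the functions $L$, $U$ and $r\mapsto\sup_{k\in\mathbb{N}}\frac{U(kr)}{L((k+1)r)}$ are all sub-exponential. Volume growth assumption: there exist $h_M>0$ and a controllable pair $(L,U)$ such that $L(r)e^{rh_M}\le\mu_M(B(o,r))\le U(r)e^{rh_M}$ for all $r>0$. $\mathrm{MVP}(\mu_M;\mathscr{H})$ is the set of locally square-integrable $f:M\to\mathscr{H}$ such that: (a) for any $z\in M$ and $r>0$, $f(z)=\frac{1}{\mu_M(B(z,r))}\int_{B(z,r)}f\,d\mu_M$; (b) there is a non-decreasing sub-exponential function $\Lambda:\mathbb{N}\to\mathbb{R}^+$, depending on $f$, with $\int_{A_k(o)}\|f(x)\|_{\mathscr{H}}^2d\mu_M(x)\le\Lambda(k)e^{2kh_M}$ for all $k\in\mathbb{N}$, where $A_k(o)=\{x\in M:k\le d(x,o)<k+1\}$; (c) $$\lim_{s\to h_M^+}\frac{\int_Me^{-2sd(x,o)}\|f(x)\|_{\mathscr{H}}^2d\mu_M(x)}{\big[\int_Me^{-sd(x,o)}d\mu_M(x)\big]^2}=0.$$ Here the partial order $\ge$ makes $\mathscr{H}$ a partially ordered vector space: $u_1\ge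 u_2$ implies $\alpha u_1\ge\alpha u_2$ for all $\alpha\in\mathbb{R}^+$ and $u_1+v\ge u_2+v$ for all $v\in\mathscr{H}$; $\mathscr{H}_+=\{u:u\ge0\}$. It is compatible with the norm if there is a constant $C>0$ such that $u_1\le u_2\le u_3$ implies $\|u_2\|\le C\max(\|u_1\|,\|u_3\|)$. $\mathrm{CMVP}(\mu_M;\mathscr{H}_+)$ is the set of $f\in\mathrm{MVP}(\mu_M;\mathscr{H})$ that are norm-continuous with values in $\mathscr{H}_+$. A series converges unconditionally if it converges and its sum does not change under any reordering of its terms. A configuration on $M$ is a collection of points of $M$ (possibly with multiplicities) with finitely many points in each relatively compact set; $\mathrm{Conf}(M)$ is the space of configurations with the usual Borel structure. Sums over $x\in X$ are taken with multiplicity. A point process on $M$ is a Borel probability measure $\Pi$ on $\mathrm{Conf}(M)$; its first intensity measure is $B\mapsto\mathbb{E}_\Pi(\#_B(\mathscr{X}))$, with $\mathscr{X}$ the random configuration and $\#_B$ the number of points in $B$. Small variance assumption: there is a constant $C>0$ depending only on $\Pi$ such that for every $f:M\to\mathbb{C}$ with $\mathbb{E}_\Pi[\sum_{x\in\mathscr{X}}(|f(x)|+|f(x)|^2)]<\infty$, $$\mathrm{Var}_\Pi\Big(\sum_{x\in\mathscr{X}}f(x)\Big)\le C\,\mathbb{E}_\Pi\Big(\sum_{x\in\mathscr{X}}|f(x)|^2\Big).$$ *)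

(* Defs.v *)
From HB Require Import structures.
From mathcomp Require Import all_boot all_order all_algebra.
From mathcomp Require Import sesquilinear complex.
From mathcomp Require Import all_classical all_reals all_analysis measurable_realfun.

Set Implicit Arguments.
Unset Strict Implicit.
Unset Printing Implicit Defensive.

Import Order.TTheory GRing.Theory Num.Theory.
Import numFieldNormedType.Exports.

Local Open Scope classical_set_scope.
Local Open Scope ring_scope.

(* The library's [metricType] is neither pointed nor complete; [Complete]
   brings both. *)
#[short(type="completeMetricType")]
HB.structure Definition CompleteMetric (K : numDomainType) :=
  { T of Metric K T & Complete T }.

Section Space.
Variables (R : realType) (M : completeMetricType R).

Definition proper_metric : Prop :=
  forall A : set M, closed A ->
    (exists z : M, exists r : R, A `<=` ball z r) -> compact A.

Definition borel := g_sigma_algebraType (@open M).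

Implicit Type mu : {measure set borel -> \bar R}.

Definition radon mu : Prop :=
  [/\ forall K : set M, compact K -> (mu K < +oo)%E,
      forall A : set borel, measurable A ->
        mu A = ereal_inf [set mu U | U in [set U : set M | open U /\ A `<=` U]]
    & forall U : set M, open U ->
        mu U = ereal_sup
          [set mu K | K in [set K : set M | compact K /\ K `<=` U]]].

End Space.

Section SubExponential.
Variable R : realType.

Definition subexp (g : R -> \bar R) : Prop :=
  forall a : R, 0 < a ->
    (g t * (expR (- a * t))%:E)%E @[t --> +oo] --> 0%E.

Definition subexp_nat (g : nat -> R) : Prop :=
  forall a : R, 0 < a -> g k * expR (- a * k%:R) @[k --> \oo] --> (0 : R).

(* The supremum is taken in [\bar R], where x / 0 = +oo for x > 0; since
   liminf L > 0 this can only concern bounded r. *)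
Definition controllable (L U : R -> R) : Prop :=
  [/\ {within `[0, +oo[, continuous L} /\ {within `[0, +oo[, continuous U},
      forall r, 0 <= r -> 0 <= L r /\ L r <= U r,
      (0 < limf_einf (EFin \o L) +oo%R)%E,
      subexp (EFin \o L) /\ subexp (EFin \o U)
    & subexp (fun r => ereal_sup
        (range (fun k : nat =>
           ((U (k%:R * r))%:E / (L (k.+1%:R * r))%:E)%E)))].

End SubExponential.

Definition volume_growth (R : realType) (M : completeMetricType R)
    (mu : {measure set (borel M) -> \bar R}) (o : M) (h : R) : Prop :=
  exists L U : R -> R, controllable L U /\
    forall r, 0 < r ->
      ((L r * expR (r * h))%:E <= mu (ball o r))%E /\
      (mu (ball o r) <= (U r * expR (r * h))%:E)%E.

Section Bochner.
Context d (T : measurableType d) (R : realType).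
Variables (mu : {measure set T -> \bar R}) (V : normedModType R).

Record simple := MkSimple {
  simple_size : nat ;
  simple_set : 'I_simple_size -> set T ;
  simple_val : 'I_simple_size -> V ;
  simple_measurable : forall i, measurable (simple_set i) ;
  simple_finite : forall i, (mu (simple_set i) < +oo)%E }.

Definition simple_eval (s : simple) (x : T) : V :=
  \sum_i (\1_(simple_set (s := s) i) x : R) *: simple_val i.

Definition simple_integral (D : set T) (s : simple) : V :=
  \sum_i fine (mu (simple_set (s := s) i `&` D)) *: simple_val i.

Definition strongly_measurable (D : set T) (f : T -> V) : Prop :=
  exists s : nat -> simple, forall x, D x ->
    simple_eval (s n) x @[n --> \oo] --> f x.

(* [f] is Bochner integrable over [D] and its integral is [v]. *)
Definition is_bochner_integral (D : set T) (f : T -> V) (v : V) : Prop :=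
  strongly_measurable D f /\
  exists s : nat -> simple,
    (\int[mu]_(x in D) (`|f x - simple_eval (s n) x|)%:E)%E @[n --> \oo]
      --> 0%E /\
    simple_integral D (s n) @[n --> \oo] --> v.

End Bochner.

Section HilbertSpace.
Variables (R : realType) (H : completeNormedModType R).

Definition norm_of_dot (dot : {dot H for idfun}) : Prop :=
  forall u : H, `|u| ^+ 2 = dot u u.

Definition partially_ordered_space (le : rel H) : Prop :=
  [/\ reflexive le, antisymmetric le, transitive le,
      forall (a : R) u1 u2, 0 <= a -> le u2 u1 -> le (a *: u2) (a *: u1)
    & forall u1 u2 v, le u2 u1 -> le (u2 + v) (u1 + v)].

Definition norm_compatible (le : rel H) : Prop :=
  exists2 C : R, 0 < C & forall u1 u2 u3, le u1 u2 -> le u2 u3 ->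
    `|u2| <= C * Num.max `|u1| `|u3|.

End HilbertSpace.

Section MeanValue.
Variables (R : realType) (M : completeMetricType R).
Variables (mu : {measure set (borel M) -> \bar R}) (o : M) (h : R).
Variable H : completeNormedModType R.

Definition weight (s : R) (z x : M) : R := expR (- s * mdist x z).

Definition variance_ratio (f : M -> H) (s : R) : \bar R :=
  ((\int[mu]_(x in setT) (weight (2 * s) o x * `|f x| ^+ 2)%:E)
   / (\int[mu]_(x in setT) (weight s o x)%:E) ^+ 2)%E.

Definition locally_square_integrable (f : M -> H) : Prop :=
  strongly_measurable mu setT f /\
  forall K : set M, compact K ->
    (\int[mu]_(x in K) (`|f x| ^+ 2)%:E < +oo)%E.

(* Balls of measure zero, over which no mean exists, carry no condition. *)
Definition mean_value (f : M -> H) : Prop :=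
  forall (z : M) (r : R), 0 < r -> (0 < mu (ball z r))%E ->
    exists2 v : H, is_bochner_integral mu (ball z r) f v
      & f z = (fine (mu (ball z r)))^-1 *: v.

Definition annulus (k : nat) : set M :=
  [set x | k%:R <= mdist x o /\ mdist x o < k.+1%:R].

Definition annular_growth (f : M -> H) : Prop :=
  exists Lam : nat -> R,
    [/\ forall k, 0 <= Lam k,
        {homo Lam : k l / (k <= l)%N >-> k <= l},
        subexp_nat Lam
      & forall k, (\int[mu]_(x in annulus k) (`|f x| ^+ 2)%:E
                   <= (Lam k * expR (2 * k%:R * h))%:E)%E].

Definition MVP (f : M -> H) : Prop :=
  [/\ locally_square_integrable f, mean_value f, annular_growth f
    & variance_ratio f s @[s --> h^'+] --> 0%E].

Definition CMVP (le : rel H) (f : M -> H) : Prop :=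
  [/\ MVP f, continuous f & forall x, le 0 (f x)].

End MeanValue.

Section Configuration.
Variables (R : realType) (M : completeMetricType R).

Record config := MkConfig {
  mult : M -> nat ;
  config_finite : forall K : set M, precompact K ->
    finite_set (K `&` [set x | (0 < mult x)%N]) }.

Lemma empty_config_finite (K : set M) : precompact K ->
  finite_set (K `&` [set x : M | (0 < (fun=> 0%N) x)%N]).
Proof.
by move=> _; rewrite (_ : _ `&` _ = set0)//; apply/seteqP; split=> x [].
Qed.

HB.instance Definition _ := gen_eqMixin config.
HB.instance Definition _ := gen_choiceMixin config.
HB.instance Definition _ := isPointed.Build config
  (MkConfig empty_config_finite).

(* \sum_(x in X) g x, with multiplicity, for g >= 0 *)
Definition config_esum (X : config) (g : M -> R) : \bar R :=
  \esum_(x in setT) ((mult X x)%:R * g x)%:E.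

Definition point_count (B : set M) (X : config) : \bar R :=
  \esum_(x in B) ((mult X x)%:R)%:E.

(* The usual Borel structure: on a proper space these events generate the
   Borel sets of the vague topology. *)
Definition counting_events : set (set config) :=
  \bigcup_(B in [set B : set (borel M) | measurable B /\ precompact (B : set M)])
    preimage_set_system setT (point_count B) (@measurable _ (\bar R)).

Definition Conf := g_sigma_algebraType counting_events.

Definition config_sum (X : config) (g : M -> R) : R :=
  fine (config_esum X (g^\+)%R) - fine (config_esum X (g^\-)%R).

Definition config_csum (X : config) (g : M -> R[i]) : R[i] :=
  (config_sum X (fun x => complex.Re (g x))
   +i* config_sum X (fun x => complex.Im (g x)))%C.

(* [e] lists the points of [X], each as often as its multiplicity; blanks
   [None] accommodate finite configurations and contribute 0 to series. *)
Definition listing (X : config) (e : nat -> option M) : Prop :=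
  forall x, ([set n | e n = Some x] #= `I_(mult X x))%card.

Definition unconditional_sum (V : normedModType R) (X : config) (g : M -> V)
    (v : V) : Prop :=
  (exists e, listing X e) /\
  forall e, listing X e -> series (fun n => oapp g 0 (e n)) @ \oo --> v.

End Configuration.

Section PointProcess.
Variables (R : realType) (M : completeMetricType R).
Variable Pi : probability (Conf M) R.

Definition first_intensity (mu : {measure set (borel M) -> \bar R}) : Prop :=
  forall B : set (borel M), measurable B ->
    (\int[Pi]_(X in setT) point_count B X = mu B)%E.

Definition cnorm : R[i] -> R := @ComplexField.Normc.normc R.

Definition cexpectation (Z : Conf M -> R[i]) : R[i] :=
  (fine ('E_Pi[fun X => complex.Re (Z X)])
   +i* fine ('E_Pi[fun X => complex.Im (Z X)]))%C.

Definition cvariance (Z : Conf M -> R[i]) : \bar R :=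
  (\int[Pi]_(X in setT) (cnorm (Z X - cexpectation Z) ^+ 2)%:E)%E.

Definition small_variance : Prop :=
  exists2 C : R, 0 < C & forall f : M -> R[i],
    measurable_fun setT ((fun x => complex.Re (f x)) : borel M -> R) ->
    measurable_fun setT ((fun x => complex.Im (f x)) : borel M -> R) ->
    (\int[Pi]_(X in setT)
       config_esum X (fun x => cnorm (f x) + cnorm (f x) ^+ 2)%R
     < +oo)%E ->
    (cvariance (fun X => config_csum X f)
     <= C%:E * \int[Pi]_(X in setT)
          config_esum X (fun x => cnorm (f x) ^+ 2)%R)%E.

End PointProcess.

(* Main.v *)
Require Import Defs.
From mathcomp Require Import all_boot all_order all_algebra.
From mathcomp Require Import sesquilinear complex.
From mathcomp Require Import all_classical all_reals all_analysis measurable_realfun.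
From mathcomp Require Import finmap ring lra.
Import Order.TTheory GRing.Theory Num.Theory.
Import numFieldNormedType.Exports.
Local Open Scope classical_set_scope.
Local Open Scope ring_scope.
Set Implicit Arguments.
Unset Strict Implicit.
Unset Printing Implicit Defensive.

(** Sums over the random configuration concentrate around their means. Let the
    weight [w] be radial about [z], bounded, and of bounded support. By the
    mean value property, the sum of [w x *: f x] over the configuration has
    mean [f z] times the integral of [w] ([radial_mean], [mean_value_ip]).
    The small variance inequality, applied to the coordinates of this sum in
    orthonormal families, bounds the mean square of its deviation from the mean
    by [C] times the integral of [w ^+ 2 * `|f| ^+ 2] ([vector_variance]). This
    has two consequences.

    Let first [w] be the indicator of an annulus about [o]. Almost surely the
    sum of [f] over the [k]-th annulus is then of order at most [expR (t * k)],
    for every [t > h] ([tame_ae]). These sums control the whole series although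
    it need not converge absolutely: [f] takes its values in a cone on which
    the norm is monotone up to a constant, so that a weighted sum over any
    finite set of far away points is dominated by a sum of whole annular sums
    ([dominated_sum], [tame_tail]). Hence the series converges unconditionally,
    for all exponents and base points at once ([tame_net_sum],
    [net_sum_unconditional]).

    Let next [w] be the exponential weight of exponent [s n] about [z]. By the
    assumption on [s], the mean squares of the deviations, divided by the
    squares of the integrals of the weights, have a finite sum over [n]; hence
    the numerators divided by these integrals tend almost surely to [f z]
    ([ratio_limit_ae]). The denominators are the numerators of the constant
    function 1. If [f z0] is nonzero, the mean value property at [z0] yields
    the summability for this function from that for [f]
    ([weighted_energy_lower]), and the quotients tend to [f z]. If [f] vanishes
    identically, there remains to exclude the empty configuration
    ([nonempty_ae]).

    The exceptional event of the second step depends on [z]; it is used along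
    a dense sequence of base points. Exponential weights about two points at
    distance [d] differ by a factor between [expR (- s n * d)] and
    [expR (s n * d)]. Positivity turns this into a bound, uniform in [n], on the
    difference of the two quotients ([ratio_perturbation]), and the limit
    extends to all base points ([ratio_extends]). *)

(** * Integration and elementary estimates *)

Lemma cvg_sum_seq (R : realType) (V : normedModType R) (I T : Type)
    (F : set_system T) (FF : Filter F) (r : seq I) (f : I -> T -> V) (l : I -> V) :
  (forall i, f i x @[x --> F] --> l i) ->
  \sum_(i <- r) f i x @[x --> F] --> \sum_(i <- r) l i.
Proof.
move=> fl; elim: r => [|i r IH].
  by rewrite big_nil; under eq_fun do rewrite big_nil; exact: cvg_cst.
by rewrite big_cons; under eq_fun do rewrite big_cons; exact: cvgD.
Qed.

(** The integral of a nonnegative function is the supremum of the integrals of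
    the simple functions below it, so it is monotone for arbitrary integrands,
    such as the distance from a function to its simple approximations. *)
Lemma le_ge0_integral d (T : measurableType d) (R : realType)
    (mu : {measure set T -> \bar R}) (D : set T) (f g : T -> \bar R) :
  (forall x, D x -> 0 <= f x)%E -> (forall x, D x -> f x <= g x)%E ->
  (\int[mu]_(x in D) f x <= \int[mu]_(x in D) g x)%E.
Proof.
move=> f0 fg; rewrite integral_mkcond [leRHS]integral_mkcond.
have h x : (0 <= (f \_ D) x)%E by apply: erestrict_ge0.
have k x : ((f \_ D) x <= (g \_ D) x)%E.
  by rewrite /patch; case: ifPn => // /set_mem; exact: fg.
rewrite !ge0_integralTE//; last by move=> x; exact: le_trans (k x).
apply: le_ereal_sup => _ [phi phif <-]; exists phi => // x.
exact: le_trans (phif x) (k x).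
Qed.

Lemma integrable_mulrl d (T : measurableType d) (R : realType)
    (mu : {measure set T -> \bar R}) (D : set T) (c : R) (g : T -> R) :
  measurable D -> mu.-integrable D (EFin \o g) ->
  mu.-integrable D (EFin \o (fun x => c * g x)).
Proof.
move=> mD ig; have := integrableZl mD c ig.
by apply: eq_integrable => // x _; rewrite /= EFinM.
Qed.

Lemma fatou_bound d (T : measurableType d) (R : realType)
    (mu : {measure set T -> \bar R}) (g : nat -> T -> \bar R) (c : \bar R) :
  (forall n, measurable_fun setT (g n)) -> (forall n x, 0 <= g n x)%E ->
  (forall n, \int[mu]_x g n x <= c)%E ->
  (\int[mu]_x limn_einf (g ^~ x) <= c)%E.
Proof.
move=> mg g0 gc; apply: le_trans (fatou _ _ _ _) _ => //.
rewrite limn_einf_lim; apply: lime_le; first exact: is_cvg_einfs.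
apply: nearW => n; apply: le_trans (gc n).
by apply: ereal_inf_lbound; exists n => /=.
Qed.

Lemma measurable_limn_einf d (T : measurableType d) (R : realType)
    (g : nat -> T -> \bar R) :
  (forall n, measurable_fun setT (g n)) ->
  measurable_fun setT (fun x => limn_einf (g ^~ x)).
Proof.
move=> mg; rewrite /limn_einf; apply: measurableT_comp => //.
apply: measurable_fun_limn_esup => n; exact: measurableT_comp.
Qed.

(** The sum of the [G n] has a finite integral, so it is finite almost
    everywhere. *)
Lemma ae_cvg0_summable d (T : measurableType d) (R : realType)
    (mu : {measure set T -> \bar R}) (G : nat -> T -> \bar R) :
  (forall n, measurable_fun setT (G n)) -> (forall n x, 0 <= G n x)%E ->
  (\sum_(0 <= n <oo) \int[mu]_x G n x < +oo)%E ->
  {ae mu, forall x, G n x @[n --> \oo] --> 0%E}.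
Proof.
move=> mG G0 Goo.
have intG : mu.-integrable setT (fun x => (\sum_(0 <= n <oo) G n x)%E).
  apply/integrableP; split.
    by apply: ge0_emeasurable_sum => // n x _ _; exact: G0.
  under eq_integral => x _ do rewrite gee0_abs ?nneseries_ge0//.
  by rewrite integral_nneseries.
have := integrable_ae measurableT intG.
apply: filterS => x /(_ I) xfin.
have xoo : (\sum_(0 <= n <oo) G n x < +oo)%E by rewrite ltey_eq xfin.
have tail := nneseries_tail_cvg xoo (fun n _ => G0 n x).
apply: (squeeze_cvge _ (cvg_cst 0%E) tail); apply: nearW => n; rewrite G0/=.
rewrite (nneseries_split n 1)//= addn1 big_nat1.
by rewrite leeDl// nneseries_ge0.
Qed.

Lemma geometric_tail (R : realType) (q : R) (K n : nat) : 0 <= q < 1 ->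
  \sum_(k <- iota K n) q ^+ k <= q ^+ K / (1 - q).
Proof.
move=> /andP[q0 q1]; have q10 : 0 < 1 - q by rewrite subr_gt0.
rewrite ler_pdivlMr//.
suff -> : (\sum_(k <- iota K n) q ^+ k) * (1 - q) = q ^+ K - q ^+ (K + n).
  by rewrite gerBl exprn_ge0.
elim: n K => [|n IH] K; first by rewrite big_nil mul0r addn0 subrr.
by rewrite big_cons mulrDl IH addnS addSn exprSr; ring.
Qed.

Lemma geometric_eseries_lty (R : realType) (A q : R) : 0 <= A -> 0 <= q < 1 ->
  (\sum_(0 <= k <oo) (A * q ^+ k)%:E < +oo)%E.
Proof.
move=> A0 /andP[q0 q1].
apply: (@le_lt_trans _ _ (A * (q ^+ 0 / (1 - q)))%:E); last by rewrite ltry.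
apply: lime_le; first by apply: is_cvg_nneseries => n _ _; rewrite lee_fin mulr_ge0 ?exprn_ge0.
apply: nearW => n; rewrite sumEFin lee_fin -mulr_sumr ler_wpM2l//.
have := @geometric_tail _ q 0 n; rewrite q0 q1 => /(_ isT).
by rewrite /index_iota subn0.
Qed.

Lemma expR_lipschitz (R : realType) (s a b : R) : 0 <= s -> 0 <= a -> 0 <= b ->
  `|expR (- s * a) - expR (- s * b)| <= s * `|a - b|.
Proof.
move=> s0; wlog ab : a b / a <= b.
  move=> hw a0 b0; have [ab|/ltW ba] := leP a b; first exact: hw.
  by rewrite distrC (distrC a) hw.
move=> a0 _; have sab : - s * b <= - s * a by rewrite ler_wnM2l// oppr_le0.
rewrite ger0_norm ?subr_ge0 ?ler_expR// distrC ger0_norm ?subr_ge0//.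
rewrite (_ : - s * b = - s * a + - (s * (b - a))); last by ring.
rewrite expRD -{1}(mulr1 (expR (- s * a))) -mulrBr.
have h1 := expR_ge1Dx (- (s * (b - a))).
have h2 : expR (- s * a) <= 1 by rewrite expR_le1 mulNr oppr_le0 mulr_ge0.
have h3 : 0 <= 1 - expR (- (s * (b - a))).
  by rewrite subr_ge0 expR_le1 oppr_le0 mulr_ge0// subr_ge0.
apply: (@le_trans _ _ (1 - expR (- (s * (b - a))))); last lra.
by rewrite -[leRHS]mul1r ler_wpM2r.
Qed.

(** * Points of a configuration in a bounded set *)

Section Points.
Variables (R : realType) (M : completeMetricType R).
Implicit Types (X : config M) (A B : set M) (x o z : M).

Lemma proper_ball_precompact o (r : R) : proper_metric M -> precompact (ball o r).
Proof.
move=> Mp; rewrite precompactE; apply: Mp; first exact: closed_closure.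
exists o, (r + 1) => x cx.
have [y []] := cx (ball x 1) (nbhsx_ballx _ _ ltr01).
rewrite !ballEmdist/= => oy xy.
apply: le_lt_trans (metric_triangle o y x) _; rewrite (metric_sym y x).
exact: ltrD.
Qed.

Lemma ball_open o (r : R) : open (ball o r).
Proof.
rewrite openE => x; rewrite ballEmdist/= => ox.
have e0 : 0 < r - mdist o x by rewrite subr_gt0.
apply: (filterS _ (nbhsx_ballx x _ e0)) => y; rewrite !ballEmdist/= => xy.
by apply: le_lt_trans (metric_triangle o x y) _; rewrite -ltrBrDl.
Qed.

Lemma borel_ball o (r : R) : measurable (ball o r : set (borel M)).
Proof. by apply: sub_sigma_algebra; exact: ball_open. Qed.

Lemma borel_continuous (g : M -> R) : continuous g ->
  measurable_fun setT (g : borel M -> R).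
Proof.
move=> cg; apply: (measurability _ (RGenOpens.measurableE R)).
move=> _ [_ [a [b ->] <-]]; rewrite setTI; apply: sub_sigma_algebra.
by move/continuousP : cg; apply; exact: interval_open.
Qed.

Lemma mdist_continuous z : continuous (fun x => mdist x z : R).
Proof.
move=> x; apply/(@cvgrPdist_lt _ R^o) => e e0.
apply: (filterS _ (nbhsx_ballx x _ e0)) => y; rewrite ballEmdist/= => xy.
rewrite ltr_norml.
have := metric_triangle x y z; have := metric_triangle y x z.
by rewrite (metric_sym y x) => h1 h2; apply/andP; split; lra.
Qed.

(** Balls of integer radius are precompact, hence have finite nets of every
    mesh [m.+1%:R^-1]; the nets together form a dense sequence. *)
Lemma proper_separable : proper_metric M ->
  exists y : nat -> M, forall (z : M) (e : R), 0 < e ->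
    exists j, mdist z (y j) < e.
Proof.
move=> Mp.
have net (K m : nat) : exists s : seq M, forall z, ball point K%:R z ->
    exists2 c, c \in s & mdist z c < m.+1%:R^-1 :> R.
  have := proper_ball_precompact point K%:R Mp.
  rewrite precompactE compact_cover => /(_ M setT (fun c => ball c m.+1%:R^-1)).
  case=> [c _|z _|D _ Dc]; first exact: ball_open.
    by exists z => //; apply: ballxx; rewrite invr_gt0 ltr0n.
  exists (finmap.enum_fset D) => z Kz.
  have [c /= cD] := Dc z (subset_closure Kz).
  by rewrite ballEmdist/= metric_sym => cz; exists c.
have [s sP] := choice (fun p : nat * nat => net p.1 p.2).
exists (fun n => if (choice.unpickle n : option (nat * nat * nat)) is Some (p, j)
                 then nth point (s p) j else point) => z e e0.
pose K := (Num.truncn (mdist point z)).+1.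
pose m := Num.truncn e^-1.
have me : m.+1%:R^-1 < e.
  by rewrite -[ltRHS]invrK ltf_pV2 ?posrE ?invr_gt0 ?ltr0n// truncnS_gt.
have [|c cs zc] := sP (K, m) z; first by rewrite ballEmdist/= truncnS_gt.
exists (choice.pickle (K, m, index c (s (K, m)))).
by rewrite choice.pickleK nth_index// (lt_trans zc).
Qed.

Lemma config_support_countable X :
  proper_metric M -> countable [set x | (0 < mult X x)%N].
Proof.
move=> Mp.
rewrite (_ : [set _ | _] = \bigcup_(k : nat) (ball point k%:R `&` [set x | (0 < mult X x)%N])).
  apply: bigcup_countable => // k _; apply: finite_set_countable.
  by apply: config_finite; exact: proper_ball_precompact.
apply/seteqP; split=> [x mx|x [k _ []]//].
exists (Num.truncn (mdist point x)).+1 => //; split=> //; rewrite ballEmdist/=.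
exact: truncnS_gt.
Qed.

(** The points of [X] in [A], each as often as its multiplicity. As [fset_set]
    is empty on infinite sets, this is meaningful for precompact [A]. *)
Definition pts X A : seq M :=
  flatten [seq nseq (mult X x) x |
    x <- fset_set (A `&` [set x | (0 < mult X x)%N])].

Lemma big_pts (V : nmodType) X A (g : M -> V) :
  \sum_(x <- pts X A) g x =
  \sum_(x <- fset_set (A `&` [set x | (0 < mult X x)%N])) g x *+ mult X x.
Proof.
rewrite /pts big_flatten big_map; apply: eq_bigr => x _.
by rewrite big_nseq; elim: (mult X x) => //= n ->; rewrite mulrS.
Qed.

Lemma count_pts X A x : precompact A ->
  count_mem x (pts X A) = if x \in A then mult X x else 0%N.
Proof.
move=> cA; have fA := config_finite X cA.
rewrite -sum1_count big_mkcond/=.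
have -> : (\sum_(i <- pts X A) (if i == x then 1 else 0) =
  \sum_(i <- pts X A) (i == x : nat))%N by apply: eq_bigr => i _; case: eqP.
rewrite (@big_pts nat X A (fun i => (i == x : nat))).
case: ifPn => xA.
  have [mx|] := boolP (0 < mult X x)%N; last first.
    rewrite lt0n negbK => /eqP mx; rewrite mx big1// => i _.
    by case: eqP => [->|]; rewrite ?mx ?mulr0n// mul0rn.
  have xin : x \in fset_set (A `&` [set x | (0 < mult X x)%N]).
    by rewrite in_fset_set//; apply/mem_set; split=> //; exact: set_mem.
  rewrite (bigD1_seq x)//=; last exact: finmap.fset_uniq.
  rewrite eqxx big1 => [|i /negPf ->]; last by rewrite mul0rn.
  by rewrite addr0 -mulr_natr mul1r natn.
rewrite big_seq big1// => i; rewrite in_fset_set// => /set_mem[iA _].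
by case: eqP => [ix|]; rewrite ?mul0rn//; move: xA; rewrite -ix notin_setE.
Qed.

Lemma mem_pts X A x : precompact A -> x \in pts X A -> A x.
Proof.
move=> cA; rewrite -has_pred1 has_count count_pts//.
by case: ifPn => // /set_mem.
Qed.

Lemma esum_pts X A (g : M -> R) : precompact A -> (forall x, 0 <= g x) ->
  \esum_(x in A) ((mult X x)%:R * g x)%:E = (\sum_(x <- pts X A) g x)%:E.
Proof.
move=> cA g0; have fA := config_finite X cA.
have -> : \esum_(x in A) ((mult X x)%:R * g x)%:E =
   \esum_(x in A `&` [set x | (0 < mult X x)%N]) ((mult X x)%:R * g x)%:E.
  rewrite [RHS]esum_mkcondr; apply: eq_esum => x Ax; case: ifPn => //.
  by rewrite notin_setE/= => /negP; rewrite -eqn0Ngt => /eqP ->; rewrite mul0r.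
rewrite esum_fset//; last by move=> i _; rewrite lee_fin mulr_ge0.
rewrite fsbig_finite// sumEFin big_pts; congr (_%:E).
by apply: eq_bigr => x _; rewrite mulr_natl.
Qed.

Lemma config_esum_pts X A (g : M -> R) : precompact A -> (forall x, 0 <= g x) ->
  (forall x, ~ A x -> g x = 0) ->
  config_esum X g = (\sum_(x <- pts X A) g x)%:E.
Proof.
move=> cA g0 gA; rewrite -esum_pts// [RHS]esum_mkcond.
apply: eq_esum => x _; case: ifPn => //; rewrite notin_setE => /gA ->.
by rewrite mulr0.
Qed.

Lemma config_sum_pts X A (g : M -> R) : precompact A ->
  (forall x, ~ A x -> g x = 0) -> config_sum X g = \sum_(x <- pts X A) g x.
Proof.
move=> cA gA; have gp0 x : 0 <= (g^\+)%R x by exact: funrpos_ge0.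
have gn0 x : 0 <= (g^\-)%R x by exact: funrneg_ge0.
rewrite /config_sum (config_esum_pts X cA gp0) ?(config_esum_pts X cA gn0).
- by rewrite -sumrB; apply: eq_bigr => x _; rewrite -[in RHS](funrposBneg g).
- by move=> x /gA gx0; rewrite /funrneg gx0 oppr0 maxxx.
- by move=> x /gA gx0; rewrite /funrpos gx0 maxxx.
Qed.

End Points.

(** * Campbell's formula *)

Section Campbell.
Variables (R : realType) (M : completeMetricType R).
Variables (mu : {measure set (borel M) -> \bar R}) (Pi : probability (Conf M) R).
Hypothesis Pi_intensity : first_intensity Pi mu.
Variable A : set M.
Hypotheses (mA : measurable (A : set (borel M))) (cA : precompact A).

Lemma sum_indic_pts (B : set M) (X : config M) :
  (\sum_(x <- pts X A) (\1_B x : R))%:E = point_count (A `&` B) X.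
Proof.
rewrite -esum_pts//.
rewrite /point_count [RHS]esum_mkcondr; apply: eq_esum => x Ax.
by rewrite indicE; case: (x \in B); rewrite ?mulr1 ?mulr0.
Qed.

Lemma precompactS (B C : set M) : B `<=` C -> precompact C -> precompact B.
Proof.
move=> BC; rewrite !precompactE => cC; apply: (subclosed_compact _ cC).
  exact: closed_closure.
exact: closure_subset.
Qed.

Lemma campbell_indic (B : set M) : measurable (B : set (borel M)) ->
  measurable_fun setT
    (fun X : Conf M => (\sum_(x <- pts X A) (\1_B x : R))%:E) /\
  (\int[Pi]_X (\sum_(x <- pts X A) (\1_B x : R))%:E = mu (A `&` B))%E.
Proof.
move=> mB; have mAB : measurable (A `&` B : set (borel M)) by exact: measurableI.
under eq_fun do rewrite sum_indic_pts.
split.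
  move=> _ Y mY; apply: sub_sigma_algebra; exists (A `&` B).
    by split=> //; apply: precompactS cA; exact: subIsetl.
  by exists Y.
rewrite -Pi_intensity//; apply: eq_integral => X _; exact: sum_indic_pts.
Qed.

Import HBNNSimple.

(** The coefficients are clipped at 0 so that all terms are nonnegative, also
    for values [c] outside of the range of [phi]. *)
Lemma nnsfunE_seq (phi : {nnsfun borel M >-> R}) (x : M) :
  phi x = \sum_(c <- fset_set (range phi))
    Num.max c 0 * \1_(phi @^-1` [set c]) x.
Proof.
rewrite {1}fimfunE fsbig_finite//=; apply: eq_big_seq => c.
rewrite in_fset_set// => /set_mem[y _ <-].
by rewrite max_l//; exact: fun_ge0.
Qed.

Lemma campbell_nnsfun (phi : {nnsfun borel M >-> R}) :
  measurable_fun setT (fun X : Conf M => (\sum_(x <- pts X A) phi x)%:E) /\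
  (\int[Pi]_X (\sum_(x <- pts X A) phi x)%:E = \int[mu]_(x in A) (phi x)%:E)%E.
Proof.
set s := fset_set (range phi).
pose F c (X : Conf M) : \bar R :=
  ((Num.max c 0)%:E * (\sum_(x <- pts X A) (\1_(phi @^-1` [set c]) x : R))%:E)%E.
have mphi c : measurable (phi @^-1` [set c] : set (borel M)).
  exact: measurable_sfunP.
have FE (X : Conf M) : (\sum_(x <- pts X A) phi x)%:E = (\sum_(c <- s) F c X)%E.
  under eq_bigr do rewrite nnsfunE_seq.
  rewrite exchange_big/= -sumEFin; apply: eq_bigr => c _.
  by rewrite -mulr_sumr EFinM.
have mF c : measurable_fun setT (F c).
  by apply: measurable_funeM; exact: (campbell_indic (mphi c)).1.
have F0 c X : (0 <= F c X)%E.
  rewrite mule_ge0 ?lee_fin ?le_max ?lexx ?orbT//.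
  by apply: sumr_ge0 => x _; rewrite indicE.
split.
  by under eq_fun do rewrite FE; exact: emeasurable_sum.
under eq_integral do rewrite FE.
rewrite ge0_integral_sum//.
transitivity (\sum_(c <- s) \int[mu]_(x in A)
   ((Num.max c 0)%:E * (\1_(phi @^-1` [set c]) x)%:E))%E.
  apply: eq_bigr => c _; rewrite ge0_integralZl//=.
  - rewrite (campbell_indic (mphi c)).2 ge0_integralZl//=.
    + by rewrite integral_indic// setIC.
    + by apply/measurable_EFinP; exact: measurable_indic.
    + by rewrite lee_fin le_max lexx orbT.
  - exact: (campbell_indic (mphi c)).1.
  - by move=> X _; rewrite lee_fin; apply: sumr_ge0 => x _; rewrite indicE.
  - by rewrite lee_fin le_max lexx orbT.
rewrite -ge0_integral_sum//.
- apply: eq_integral => x _; rewrite [in RHS]nnsfunE_seq -sumEFin.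
  by apply: eq_bigr => c _; rewrite EFinM.
- move=> c; apply: measurable_funeM; apply/measurable_EFinP.
  exact: measurable_indic.
- by move=> c x _; rewrite -EFinM lee_fin mulr_ge0// le_max lexx orbT.
Qed.

(** On indicators this is the definition of the first intensity; monotone
    approximation by simple functions commutes with the finite sums over
    points and with both integrals. *)
Lemma campbell (g : M -> R) : (forall x, 0 <= g x) ->
  measurable_fun setT (g : borel M -> R) ->
  measurable_fun setT (fun X : Conf M => \sum_(x <- pts X A) g x) /\
  (\int[Pi]_X (\sum_(x <- pts X A) g x)%:E = \int[mu]_(x in A) (g x)%:E)%E.
Proof.
move=> g0 mg.
have mg' : measurable_fun setT (EFin \o g : borel M -> \bar R).
  exact/measurable_EFinP.
pose h := nnsfun_approx measurableT mg'.
have hg x : (h n x)%:E @[n --> \oo] --> (g x)%:E.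
  by apply: cvg_nnsfun_approx => // y _; rewrite lee_fin.
have hg' x : h n x @[n --> \oo] --> g x by exact: (fine_cvg (hg x)).
have hnd x : {homo (fun n => h n x) : n m / (n <= m)%N >-> n <= m}.
  by move=> n m nm; exact/lefP/nd_nnsfun_approx.
have sg X : \sum_(x <- pts X A) h n x @[n --> \oo] --> \sum_(x <- pts X A) g x.
  exact: (@cvg_sum_seq R R^o).
have ms : measurable_fun setT (fun X : Conf M => \sum_(x <- pts X A) g x).
  apply: (@measurable_fun_cvg _ _ _ _
    (fun n (X : Conf M) => \sum_(x <- pts X A) h n x)) => // n.
  by apply/measurable_EFinP; exact: (campbell_nnsfun (h n)).1.
split=> //.
have cvg1 : (\int[Pi]_X (\sum_(x <- pts X A) h n x)%:E @[n --> \oo] -->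
    \int[Pi]_X (\sum_(x <- pts X A) g x)%:E)%E.
  have -> : (\int[Pi]_X (\sum_(x <- pts X A) g x)%:E =
     \int[Pi]_X limn (fun n => (\sum_(x <- pts X A) h n x)%:E))%E.
    apply: eq_integral => X _; apply/esym/cvg_lim => //.
    by apply: cvg_EFin; [exact: nearW|exact: sg].
  apply: cvg_monotone_convergence => //.
  - by move=> n; exact: (campbell_nnsfun (h n)).1.
  - by move=> n X _; rewrite lee_fin sumr_ge0.
  - by move=> X _ n m nm; rewrite lee_fin ler_sum// => x _; exact: hnd.
have cvg2 : (\int[mu]_(x in A) (h n x)%:E @[n --> \oo] -->
    \int[mu]_(x in A) (g x)%:E)%E.
  have -> : (\int[mu]_(x in A) (g x)%:E =
     \int[mu]_(x in A) limn (fun n => (h n x)%:E))%E.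
    by apply: eq_integral => x _; apply/esym/cvg_lim => //.
  apply: cvg_monotone_convergence => //.
  - by move=> n; apply/measurable_EFinP; exact: measurable_funTS.
  - by move=> n x _; rewrite lee_fin.
  - by move=> x _ n m nm; rewrite lee_fin; exact: hnd.
move: cvg1; under eq_fun do rewrite (campbell_nnsfun _).2.
by move=> cvg1; exact: cvg_unique cvg1 cvg2.
Qed.

End Campbell.

(** * Second moments of scalar sums *)

Section Variance.
Variables (R : realType) (M : completeMetricType R).
Variables (mu : {measure set (borel M) -> \bar R}) (Pi : probability (Conf M) R).
Hypothesis Pi_intensity : first_intensity Pi mu.

Lemma campbell_integrable (A : set M) (g : M -> R) :
  measurable (A : set (borel M)) -> precompact A -> (forall x, 0 <= g x) ->
  measurable_fun setT (g : borel M -> R) ->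
  (\int[mu]_(x in A) (g x)%:E < +oo)%E ->
  Pi.-integrable setT (fun X : Conf M => (\sum_(x <- pts X A) g x)%:E).
Proof.
move=> mA cA g0 mg goo; have [ms intE] := campbell Pi_intensity mA cA g0 mg.
apply/integrableP; split; first exact/measurable_EFinP.
under eq_integral => X _ do rewrite gee0_abs ?lee_fin ?sumr_ge0//.
by rewrite intE.
Qed.

Lemma campbell_signed (A : set M) (g : M -> R) :
  measurable (A : set (borel M)) -> precompact A ->
  measurable_fun setT (g : borel M -> R) ->
  (\int[mu]_(x in A) `|g x|%:E < +oo)%E ->
  (\int[Pi]_X (\sum_(x <- pts X A) g x)%:E = \int[mu]_(x in A) (g x)%:E)%E.
Proof.
move=> mA cA mg goo.
have gp0 x : 0 <= (g^\+)%R x by exact: funrpos_ge0.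
have gn0 x : 0 <= (g^\-)%R x by exact: funrneg_ge0.
have mgp : measurable_fun setT (g^\+ : borel M -> R) by exact: measurable_funrpos.
have mgn : measurable_fun setT (g^\- : borel M -> R) by exact: measurable_funrneg.
have le_pos x : (g^\+)%R x <= `|g x|.
  by rewrite /funrpos ge_max ler_norm normr_ge0.
have le_neg x : (g^\-)%R x <= `|g x|.
  by rewrite /funrneg ge_max -normrN ler_norm normr_ge0.
have gpoo : (\int[mu]_(x in A) ((g^\+)%R x)%:E < +oo)%E.
  by apply: le_lt_trans goo; apply: le_ge0_integral => //= x _; rewrite lee_fin.
have gnoo : (\int[mu]_(x in A) ((g^\-)%R x)%:E < +oo)%E.
  by apply: le_lt_trans goo; apply: le_ge0_integral => //= x _; rewrite lee_fin.
have int_pos : mu.-integrable A (EFin \o (g^\+)%R).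
  apply/integrableP; split; first by apply/measurable_EFinP; exact: measurable_funTS.
  apply: le_lt_trans gpoo; apply: le_ge0_integral => //= x _.
  by rewrite lee_fin ger0_norm.
have int_neg : mu.-integrable A (EFin \o (g^\-)%R).
  apply/integrableP; split; first by apply/measurable_EFinP; exact: measurable_funTS.
  apply: le_lt_trans gnoo; apply: le_ge0_integral => //= x _.
  by rewrite lee_fin ger0_norm.
transitivity (\int[Pi]_X ((\sum_(x <- pts X A) (g^\+)%R x) -
    (\sum_(x <- pts X A) (g^\-)%R x))%:E)%E.
  apply: eq_integral => X _; congr (_%:E); rewrite -sumrB.
  by apply: eq_bigr => x _; rewrite -[in LHS](funrposBneg g).
rewrite integralB_EFin//; [|exact: campbell_integrable..].
rewrite (campbell Pi_intensity mA cA gp0 mgp).2.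
rewrite (campbell Pi_intensity mA cA gn0 mgn).2 -integralB_EFin//.
by apply: eq_integral => x _; rewrite -[in RHS](funrposBneg g).
Qed.

Lemma bounded_integral_lty (A : set M) (g : M -> R) (B : R) :
  measurable (A : set (borel M)) -> (mu A < +oo)%E ->
  (forall x, 0 <= g x <= B) ->
  (\int[mu]_(x in A) (g x)%:E < +oo)%E.
Proof.
move=> mA Aoo gB; apply: (@le_lt_trans _ _ (\int[mu]_(x in A) B%:E)%E).
  by apply: le_ge0_integral => // x _; rewrite lee_fin; have /andP[] := gB x.
rewrite integral_cst// -ge0_fin_numE ?fin_numM// ?ge0_fin_numE//.
rewrite mule_ge0// lee_fin; have /andP[] := gB point; exact: le_trans.
Qed.

Lemma cnormR (x : R) : @cnorm R (x +i* 0)%C = `|x|.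
Proof. by rewrite /cnorm /=  expr0n/= addr0 sqrtr_sqr. Qed.

Lemma measurable_sum_pts (A : set M) (g : M -> R) :
  measurable (A : set (borel M)) -> precompact A ->
  measurable_fun setT (g : borel M -> R) ->
  measurable_fun setT (fun X : Conf M => \sum_(x <- pts X A) g x).
Proof.
move=> mA cA mg.
rewrite (_ : (fun _ => _) = (fun X : Conf M => \sum_(x <- pts X A) (g^\+)%R x -
    \sum_(x <- pts X A) (g^\-)%R x)); last first.
  apply/funext => X; rewrite -sumrB.
  by apply: eq_bigr => x _; rewrite -[in LHS](funrposBneg g).
apply: measurable_funB; apply: (campbell Pi_intensity mA cA _ _).1.
- by move=> x; exact: funrpos_ge0.
- exact: measurable_funrpos.
- by move=> x; exact: funrneg_ge0.
- exact: measurable_funrneg.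
Qed.

(** The small variance inequality for real functions that are bounded and
    vanish outside of a precompact set; the sums over the configuration are
    then finite. *)
Definition variance_bound (C : R) : Prop :=
  forall (A : set M) (phi : M -> R) (B : R),
  measurable (A : set (borel M)) -> precompact A -> (mu A < +oo)%E ->
  measurable_fun setT (phi : borel M -> R) ->
  (forall x, `|phi x| <= B) -> (forall x, ~ A x -> phi x = 0) ->
  (\int[Pi]_X ((\sum_(x <- pts X A) phi x
                - fine (\int[mu]_(x in A) (phi x)%:E)) ^+ 2)%:E
   <= C%:E * \int[mu]_(x in A) (phi x ^+ 2)%:E)%E.

(** A real function is a complex one with vanishing imaginary part, and
    Campbell's formula computes the expectation in the complex variance. *)
Lemma scalar_variance : small_variance Pi ->
  exists2 C : R, 0 < C & variance_bound C.
Proof.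
move=> [C C0 PiC]; exists C => // A phi B mA cA Aoo mphi phiB phiA.
have B0 : 0 <= B by exact: le_trans (phiB point).
pose f x := (phi x +i* 0)%C : R[i].
have sumE (X : Conf M) : config_csum X f = ((\sum_(x <- pts X A) phi x) +i* 0)%C.
  rewrite /config_csum /=; congr (_ +i* _)%C.
    exact: config_sum_pts.
  by rewrite (config_sum_pts X cA)// big1.
have m2 : measurable_fun setT (fun x : borel M => `|phi x| + `|phi x| ^+ 2).
  apply: measurable_funD; first exact: measurableT_comp.
  by apply: measurable_funX; exact: measurableT_comp.
have m2' : measurable_fun setT (fun x : borel M => phi x ^+ 2).
  exact: measurable_funX.
have phi2 x : `|phi x| ^+ 2 = phi x ^+ 2 by rewrite -normrX ger0_norm ?sqr_ge0.
have le2 x : phi x ^+ 2 <= B ^+ 2.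
  by rewrite -phi2 ler_pXn2r// nnegrE.
have esum1 (X : Conf M) : config_esum X (fun x => cnorm (f x) + cnorm (f x) ^+ 2) =
    (\sum_(x <- pts X A) (`|phi x| + `|phi x| ^+ 2))%:E.
  under [X in config_esum _ X]eq_fun do rewrite /f cnormR.
  apply: config_esum_pts => // x.
  by move=> /phiA ->; rewrite normr0 expr0n addr0.
have esum2 (X : Conf M) : config_esum X (fun x => cnorm (f x) ^+ 2) =
    (\sum_(x <- pts X A) (phi x ^+ 2))%:E.
  under [X in config_esum _ X]eq_fun do rewrite /f cnormR phi2.
  apply: config_esum_pts => // x; rewrite ?sqr_ge0//.
  by move=> /phiA ->; rewrite expr0n.
have := PiC f mphi.
rewrite (_ : (fun x => complex.Im (f x)) = cst 0)//.
move=> /(_ (measurable_cst _)).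
under eq_integral do rewrite esum1.
rewrite (campbell Pi_intensity mA cA _ m2).2; last first.
  by move=> x; rewrite addr_ge0// sqr_ge0.
move=> /(_ _)/wrap[].
  apply: (@bounded_integral_lty _ _ (B + B ^+ 2)) => // x.
  by rewrite addr_ge0 ?sqr_ge0//= lerD// phi2.
under eq_integral do rewrite esum2.
rewrite (campbell Pi_intensity mA cA _ m2').2; last first.
  by move=> x; rewrite sqr_ge0.
apply: le_trans; rewrite /cvariance le_eqVlt; apply/orP; left; apply/eqP.
apply: eq_integral => X _; congr (_%:E).
rewrite sumE /cexpectation.
have -> : ('E_Pi[(fun X => complex.Re (config_csum X f))] =
    \int[mu]_(x in A) (phi x)%:E)%E.
  rewrite unlock -(@campbell_signed A)//.
    by apply: eq_integral => Y _; rewrite sumE.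
  apply: (@bounded_integral_lty _ _ B) => // x.
  by rewrite normr_ge0 phiB.
have -> : ('E_Pi[(fun X => complex.Im (config_csum X f))] = 0)%E.
  by rewrite unlock; apply: integral0_eq => Y _; rewrite sumE.
rewrite [X in cnorm X](_ : _ = ((\sum_(x <- pts X A) phi x
    - fine (\int[mu]_(x in A) (phi x)%:E)%E) +i* 0)%C); last first.
  by apply/eqP; rewrite eq_complex /= subr0 !eqxx.
rewrite cnormR.
by rewrite -normrX ger0_norm ?sqr_ge0.
Qed.

End Variance.

(** * Inner products and orthonormal families *)

Section InnerProduct.
Variables (R : realType) (V : normedModType R).

(** A predicate on binary functions, so that multiplication on the real line
    is covered along with the form of the given Hilbert space. *)
Definition inner_product (ip : V -> V -> R) : Prop :=
  [/\ forall a u v w, ip (a *: u + v) w = a * ip u w + ip v w,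
      forall u v, ip u v = ip v u & forall u, `|u| ^+ 2 = ip u u].

Variable ip : V -> V -> R.
Hypothesis ipP : inner_product ip.

Let ipC u v : ip u v = ip v u. Proof. by case: ipP. Qed.
Let ipN u : `|u| ^+ 2 = ip u u. Proof. by case: ipP. Qed.
Let ipL a u v w : ip (a *: u + v) w = a * ip u w + ip v w.
Proof. by case: ipP. Qed.

Lemma ipDl u v w : ip (u + v) w = ip u w + ip v w.
Proof. by have := ipL 1 u v w; rewrite scale1r mul1r. Qed.

Lemma ip0l w : ip 0 w = 0.
Proof. by apply: (@addrI _ (ip 0 w)); rewrite -ipDl !addr0. Qed.

Lemma ipZl a u w : ip (a *: u) w = a * ip u w.
Proof. by have := ipL a u 0 w; rewrite addr0 ip0l addr0. Qed.

Lemma ipBl u v w : ip (u - v) w = ip u w - ip v w.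
Proof. by rewrite ipDl -scaleN1r ipZl mulN1r. Qed.

Lemma ip_suml (I : Type) (s : seq I) (F : I -> V) w :
  ip (\sum_(i <- s) F i) w = \sum_(i <- s) ip (F i) w.
Proof.
elim: s => [|i s IH]; first by rewrite !big_nil ip0l.
by rewrite !big_cons ipDl IH.
Qed.

Lemma normB_sqr u v : `|u - v| ^+ 2 = `|u| ^+ 2 - 2 * ip u v + `|v| ^+ 2.
Proof.
rewrite !ipN ipBl (ipC u (u - v)) (ipC v (u - v)) !ipBl (ipC v u).
by ring.
Qed.

(** Expand the square norm of [ip e e *: u - ip u e *: e]. *)
Lemma cauchy_schwarz u e : `|ip u e| <= `|u| * `|e|.
Proof.
have [->|e0] := eqVneq e 0; first by rewrite ipC ip0l !normr0 mulr0.
have e20 : 0 < ip e e by rewrite -ipN exprn_gt0// normr_gt0.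
rewrite -(@ler_pXn2r _ 2)// ?nnegrE ?mulr_ge0// exprMn -normrX.
rewrite (ger0_norm (sqr_ge0 _)) !ipN.
have := sqr_ge0 `|ip e e *: u - ip u e *: e|.
rewrite normB_sqr !ipN !ipZl (ipC u (_ *: u)) (ipC u (_ *: e)) (ipC e (_ *: e)).
rewrite !ipZl (ipC e u) => h; rewrite -(ler_pM2l e20); move: h.
lra.
Qed.

Lemma ip_continuous e : continuous (fun u => ip u e).
Proof.
move=> u; apply/(@cvgrPdist_lt _ R^o) => r r0.
have h : 0 < r / (`|e| + 1) by rewrite divr_gt0// ltr_wpDl.
have /cvgrPdist_lt/(_ _ h) : id v @[v --> u] --> u by [].
apply: filterS => v; rewrite ltr_pdivlMr ?ltr_wpDl// => uv.
rewrite -ipBl; apply: le_lt_trans (cauchy_schwarz _ _) _.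
by apply: le_lt_trans uv; rewrite ler_wpM2l// lerDl.
Qed.

Fixpoint orthonormal_seq (E : seq V) : Prop :=
  if E is e :: E' then
    [/\ `|e| = 1, forall e', e' \in E' -> ip e' e = 0 & orthonormal_seq E']
  else True.

Definition ortho_proj (E : seq V) (u : V) : V := \sum_(e <- E) ip u e *: e.

(** The square norm of [ortho_proj E u], for orthonormal [E]. *)
Definition proj_energy (E : seq V) (u : V) : R := \sum_(e <- E) ip u e ^+ 2.

Lemma proj_lin E a u v : ortho_proj E (a *: u + v) = a *: ortho_proj E u + ortho_proj E v.
Proof.
rewrite /ortho_proj scaler_sumr -big_split/=; apply: eq_bigr => e _.
by rewrite ipL scalerDl scalerA.
Qed.

Lemma projB E u v : ortho_proj E (u - v) = ortho_proj E u - ortho_proj E v.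
Proof.
by rewrite addrC -scaleN1r proj_lin scaleN1r addrC.
Qed.

Lemma ip_proj E u e : orthonormal_seq E -> e \in E -> ip (ortho_proj E u) e = ip u e.
Proof.
rewrite /ortho_proj; elim: E => // e0 E IH [e01 oe oE].
rewrite inE big_cons ipDl ipZl => /predU1P[->|eE].
  rewrite -ipN e01 expr1n mulr1 ip_suml big_seq big1 ?addr0// => e' e'E.
  by rewrite ipZl oe// mulr0.
by rewrite (ipC e0) (oe e eE) mulr0 add0r IH.
Qed.

Lemma pythagoras E u : orthonormal_seq E ->
  `|u - ortho_proj E u| ^+ 2 = `|u| ^+ 2 - proj_energy E u.
Proof.
move=> oE; rewrite normB_sqr.
have h v : (forall e, e \in E -> ip v e = ip u e) -> ip v (ortho_proj E u) = proj_energy E u.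
  move=> vu; rewrite ipC ip_suml /proj_energy big_seq [RHS]big_seq.
  by apply: eq_bigr => e eE; rewrite ipZl (ipC e v) vu.
rewrite (h u)// [X in _ + X]ipN (h (ortho_proj E u)); first by ring.
by move=> e eE; exact: ip_proj.
Qed.

Lemma bessel E u : orthonormal_seq E -> proj_energy E u <= `|u| ^+ 2.
Proof. by move=> oE; rewrite -subr_ge0 -pythagoras// sqr_ge0. Qed.

Lemma proj_energy_ge0 E u : 0 <= proj_energy E u.
Proof. by apply: sumr_ge0 => e _; exact: sqr_ge0. Qed.

(** The projection of [u] is at least as close to [u] as any [c] that the
    projection fixes. *)
Lemma proj_energy_approx E u c : orthonormal_seq E -> ortho_proj E c = c ->
  `|u| ^+ 2 - `|u - c| ^+ 2 <= proj_energy E u.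
Proof.
move=> oE Pc.
have : `|u - ortho_proj E u| ^+ 2 <= `|u - c| ^+ 2.
  rewrite (_ : u - ortho_proj E u = (u - c) - ortho_proj E (u - c)); last first.
    by rewrite projB Pc opprB addrA subrK.
  by rewrite pythagoras// lerBlDr lerDl proj_energy_ge0.
by rewrite pythagoras//; lra.
Qed.

(** Gram-Schmidt orthonormalization, one vector at a time: what remains of a
    vector after projection is normalized and added, unless it is 0. *)
Lemma orthonormal_span (vs : seq V) :
  exists E, orthonormal_seq E /\ forall v, v \in vs -> ortho_proj E v = v.
Proof.
elim: vs => [|v vs [E [oE Evs]]]; first by exists [::].
pose r := v - ortho_proj E v.
have rE e : e \in E -> ip r e = 0.
  by move=> eE; rewrite ipBl ip_proj// subrr.
have [r0|r0] := eqVneq r 0.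
  exists E; split=> // u; rewrite inE => /predU1P[->|/Evs//].
  by apply/eqP; rewrite eq_sym -subr_eq0; apply/eqP.
have nr0 : `|r| != 0 by rewrite normr_eq0.
pose e := `|r|^-1 *: r.
have fixE u : ortho_proj E u = u -> ip u e = 0.
  move=> <-; rewrite ip_suml big_seq big1// => e' e'E.
  by rewrite ipZl (ipC e' e) ipZl rE// !mulr0.
have Pe : ortho_proj (e :: E) v = v.
  rewrite /ortho_proj big_cons -/(ortho_proj E v).
  have -> : ip v e = `|r|.
    rewrite -[in ip v e](subrK (ortho_proj E v) v) -/r ipDl (fixE (ortho_proj E v)).
      by rewrite addr0 ipC ipZl -ipN expr2 mulrA mulVf// mul1r.
    rewrite {1}/ortho_proj [RHS]/ortho_proj big_seq [RHS]big_seq.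
    by apply: eq_bigr => e' e'E; rewrite ip_proj.
  by rewrite scalerA mulfV// scale1r subrK.
exists (e :: E); split => [|u].
  split=> //; last by move=> e' e'E; rewrite ipC ipZl rE// mulr0.
  by rewrite normrZ normfV normr_id mulVf.
rewrite inE => /predU1P[->//|uvs]; have Pu := Evs u uvs.
by rewrite /ortho_proj big_cons -/(ortho_proj E u) fixE// scale0r add0r.
Qed.

End InnerProduct.

Lemma dot_inner_product (R : realType) (H : normedModType R)
    (dot : {dot H for idfun}) :
  (forall u : H, `|u| ^+ 2 = dot u u) -> inner_product dot.
Proof.
move=> dotN; split=> // [a u v w|u v].
  by rewrite linearDl linearZl_LR.
by rewrite hermC expr0 mul1r.
Qed.

(** * Second moments of vector-valued sums *)

Section VectorVariance.
Variables (R : realType) (M : completeMetricType R).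
Variables (mu : {measure set (borel M) -> \bar R}) (Pi : probability (Conf M) R).
Hypothesis Pi_intensity : first_intensity Pi mu.
Variable C : R.
Hypotheses (C_gt0 : 0 < C) (PiC : variance_bound mu Pi C).
Variables (V : normedModType R) (ip : V -> V -> R).
Hypothesis ipP : inner_product ip.
Variable f : M -> V.
Hypothesis f_cont : continuous f.
Hypothesis M_proper : proper_metric M.

Lemma continuous_ip e : continuous (fun x => ip (f x) e).
Proof.
move=> x; apply: (@continuous_comp _ _ _ f (ip ^~ e)); first exact: f_cont.
exact: ip_continuous.
Qed.

Lemma measurable_ip e : measurable_fun setT ((fun x => ip (f x) e) : borel M -> R).
Proof. by apply: borel_continuous; exact: continuous_ip. Qed.

Lemma measurable_normf : measurable_fun setT ((fun x => `|f x|) : borel M -> R).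
Proof.
apply: borel_continuous => x.
by apply: (@continuous_comp _ _ _ f); [exact: f_cont|exact: norm_continuous].
Qed.

Lemma bounded_on_precompact (A : set M) : precompact A ->
  exists2 B : R, 0 < B & forall x, A x -> `|f x| <= B.
Proof.
rewrite precompactE => cA.
have cfA : compact (f @` closure A).
  by apply: continuous_compact => //; exact: continuous_subspaceT.
have [B [Bre HB]] := compact_bounded cfA.
exists (`|B| + 1); first by rewrite ltr_wpDl.
move=> x Ax; apply: (HB (`|B| + 1)).
  by rewrite (le_lt_trans (ler_norm B))// ltrDl.
by exists x => //; exact: subset_closure.
Qed.

Variables (A : set M) (w : M -> R) (W : R) (a : R) (z : M).
Hypotheses (mA : measurable (A : set (borel M))) (cA : precompact A)
  (Aoo : (mu A < +oo)%E).
Hypotheses (mw : measurable_fun setT (w : borel M -> R))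
  (wW : forall x, `|w x| <= W) (wA : forall x, ~ A x -> w x = 0).
Hypothesis mean : forall e : V,
  fine (\int[mu]_(x in A) (w x * ip (f x) e)%:E) = a * ip (f z) e.

(** When [f] has the mean value property, the mean of the sum is a multiple of
    [f z], for [w] radial about [z]. *)
Definition deviation (X : Conf M) : V :=
  \sum_(x <- pts X A) w x *: f x - a *: f z.

Let phi e x := w x * ip (f x) e.

Let mphi e : measurable_fun setT (phi e : borel M -> R).
Proof. by apply: measurable_funM => //; exact: measurable_ip. Qed.

Lemma ip_deviation (X : Conf M) e : ip (deviation X) e =
  \sum_(x <- pts X A) phi e x - fine (\int[mu]_(x in A) (phi e x)%:E).
Proof.
rewrite /deviation (ipBl ipP) (ipZl ipP) (ip_suml ipP) mean; congr (_ - _).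
by apply: eq_bigr => x _; rewrite (ipZl ipP).
Qed.

Lemma measurable_ip_deviation e :
  measurable_fun setT (fun X : Conf M => ip (deviation X) e).
Proof.
under eq_fun do rewrite ip_deviation.
by apply: measurable_funB => //; apply: (measurable_sum_pts Pi_intensity).
Qed.

(** The inner product of the deviation with [e] is a centered scalar sum, to
    which [variance_bound] applies; the bounds for the members of [E] are
    summed by the inequality of Bessel. *)
Lemma energy_bound (E : seq V) : orthonormal_seq ip E ->
  (\int[Pi]_X (proj_energy ip E (deviation X))%:E <=
   C%:E * \int[mu]_(x in A) (w x ^+ 2 * `|f x| ^+ 2)%:E)%E.
Proof.
move=> oE.
have [B B0 fB] := bounded_on_precompact cA.
have bnd e : (\int[Pi]_X (ip (deviation X) e ^+ 2)%:E <=
    C%:E * \int[mu]_(x in A) (phi e x ^+ 2)%:E)%E.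
  under eq_integral do rewrite ip_deviation.
  apply: (PiC (B := W * (B * `|e|))) => // x; last by move/wA; rewrite /phi => ->; rewrite mul0r.
  have [Ax|/wA wx0] := pselect (A x); last first.
    rewrite /phi wx0 mul0r normr0 !mulr_ge0//; last exact: ltW.
    exact: le_trans (wW point).
  rewrite normrM ler_pM//; apply: le_trans (cauchy_schwarz ipP _ _) _.
  by rewrite ler_wpM2r// fB.
under eq_integral do rewrite /proj_energy -sumEFin.
rewrite ge0_integral_sum//; last 2 first.
- move=> e; apply/measurable_EFinP; apply: measurable_funX.
  exact: measurable_ip_deviation.
- by move=> e X _; rewrite lee_fin sqr_ge0.
apply: (@le_trans _ _ (\sum_(e <- E) C%:E * \int[mu]_(x in A) (phi e x ^+ 2)%:E)%E).
  by apply: lee_sum => e _.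
rewrite -ge0_sume_distrr; last first.
  by move=> e _; apply: integral_ge0 => x _; rewrite lee_fin sqr_ge0.
apply: lee_wpmul2l; first by rewrite lee_fin ltW.
rewrite -ge0_integral_sum//; last 2 first.
- move=> e; apply/measurable_EFinP; apply: measurable_funTS.
  exact: measurable_funX.
- by move=> e X _; rewrite lee_fin sqr_ge0.
apply: le_ge0_integral => x _.
  by apply: sume_ge0 => e _; rewrite lee_fin sqr_ge0.
rewrite sumEFin lee_fin.
under eq_bigr do rewrite /phi exprMn.
by rewrite -mulr_sumr ler_wpM2l ?sqr_ge0// (bessel ipP).
Qed.

(** Parseval's identity. The deviation is a combination of values of [f], and
    each of these is a limit of values of [f] along a dense sequence, so it is
    approximated from the spans of finitely many terms of that sequence. *)
Lemma energy_cvg : exists E : nat -> seq V, (forall m, orthonormal_seq ip (E m)) /\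
  forall X, proj_energy ip (E m) (deviation X) @[m --> \oo]
    --> `|deviation X| ^+ 2.
Proof.
have [y yP] := proper_separable M_proper.
have [E EP] := choice (fun m => orthonormal_span ipP [seq f (y j) | j <- iota 0 m]).
have oE m : orthonormal_seq ip (E m) by have [] := EP m.
exists E; split=> // X.
pose good u := forall eps : R, 0 < eps -> \forall m \near \oo,
  exists2 c, ortho_proj ip (E m) c = c & `|u - c| < eps.
have good_f x : good (f x).
  move=> eps eps0; have /cvgrPdist_lt/(_ _ eps0)/nbhs_ballP[d /= d0 xd] := @f_cont x.
  have [j xj] := yP x d d0.
  exists j.+1 => // m /= jm; exists (f (y j)).
    by apply: (EP m).2; apply/mapP; exists j => //; rewrite mem_iota.
  by apply: xd; rewrite ballEmdist.
have goodD u v : good u -> good v -> good (u + v).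
  move=> gu gv eps eps0; have e20 : 0 < eps / 2 by rewrite divr_gt0.
  have := gv _ e20; apply: filterS2 (gu _ e20) => m [c Pc uc] [c' Pc' vc].
  exists (c + c'); last first.
    by rewrite opprD addrACA (splitr eps) (le_lt_trans (ler_normD _ _))// ltrD.
  by have := proj_lin ipP (E m) 1 c c'; rewrite !scale1r Pc Pc'.
have P0 m : ortho_proj ip (E m) 0 = 0.
  by rewrite -[X in ortho_proj _ _ X](subrr 0) (projB ipP) subrr.
have good0 : good 0.
  by move=> eps eps0; apply: nearW => m; exists 0; rewrite ?subr0 ?normr0.
have goodZ b u : good u -> good (b *: u).
  move=> gu eps eps0; have e20 : 0 < eps / (`|b| + 1).
    by rewrite divr_gt0// ltr_wpDl.
  apply: filterS (gu _ e20) => m [c Pc uc]; exists (b *: c).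
    by have := proj_lin ipP (E m) b c 0; rewrite P0 !addr0 Pc.
  rewrite -scalerBr normrZ; move: uc; rewrite ltr_pdivlMr ?ltr_wpDl// mulrC.
  by apply: le_lt_trans; rewrite ler_wpM2r// lerDl.
have goodU : good (deviation X).
  rewrite /deviation -scaleNr; apply: (goodD); last exact: (goodZ).
  elim: (pts X A) => [|x s IH]; first by rewrite big_nil.
  by rewrite big_cons; apply: (goodD) => //; exact: (goodZ).
apply/(@cvgrPdist_lt _ R^o) => eps eps0.
have d0 : 0 < Num.min 1 eps by rewrite lt_min ltr01.
apply: filterS (goodU _ d0) => m [c Pc Uc].
have h1 := bessel ipP (deviation X) (oE m).
have h2 := proj_energy_approx ipP (deviation X) (oE m) Pc.
rewrite ger0_norm ?subr_ge0// ltrBlDr -ltrBlDl.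
apply: lt_le_trans h2; rewrite ltrD2l ltrN2.
move: Uc; rewrite lt_min => /andP[c1 ce].
by apply: le_lt_trans ce; rewrite expr2 ler_piMl// ltW.
Qed.

Lemma measurable_deviation :
  measurable_fun setT (fun X : Conf M => `|deviation X| ^+ 2).
Proof.
have [E [oE Ecvg]] := energy_cvg.
apply: (@measurable_fun_cvg _ _ _ _
  (fun m (X : Conf M) => proj_energy ip (E m) (deviation X))) => // m.
apply: measurable_sum => e; apply: measurable_funX.
exact: measurable_ip_deviation.
Qed.

(** Fatou's lemma along the projections of [energy_cvg], for which
    [energy_bound] gives a common bound. *)
Theorem vector_variance :
  (\int[Pi]_X (`|deviation X| ^+ 2)%:E <=
   C%:E * \int[mu]_(x in A) (w x ^+ 2 * `|f x| ^+ 2)%:E)%E.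
Proof.
have [E [oE Ecvg]] := energy_cvg.
have mE m : measurable_fun setT
    (fun X : Conf M => (proj_energy ip (E m) (deviation X))%:E).
  apply/measurable_EFinP.
  apply: measurable_sum => e; apply: measurable_funX.
  exact: measurable_ip_deviation.
apply: le_trans (fatou_bound (c := _) mE _ (fun m => energy_bound (oE m))).
  rewrite le_eqVlt; apply/orP; left; apply/eqP; apply: eq_integral => X _.
  apply/esym; apply: (cvg_limn_einf_sup _).1.
  by apply: cvg_EFin; [exact: nearW|exact: Ecvg].
by move=> m X; rewrite lee_fin proj_energy_ge0.
Qed.

End VectorVariance.

(** * Mean values against radial weights *)

Section RadialMean.
Variables (R : realType) (M : completeMetricType R).
Variable mu : {measure set (borel M) -> \bar R}.
Hypothesis mu_ball : forall (z : M) (r : R), (mu (ball z r) < +oo)%E.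

Lemma ball_le0 (z : M) (r : R) : r <= 0 -> ball z r = set0.
Proof.
move=> r0; rewrite ballEmdist; apply/seteqP; split=> // x /=.
by move=> /lt_le_trans/(_ r0); rewrite ltNge mdist_ge0.
Qed.

Lemma ball_integrable (z : M) (r B : R) (g : M -> R) (D : set M) :
  D `<=` ball z r -> measurable (D : set (borel M)) ->
  measurable_fun setT (g : borel M -> R) ->
  (forall x, ball z r x -> `|g x| <= B) ->
  mu.-integrable D (EFin \o g).
Proof.
move=> Dr mD mg gB; apply: (@integrableS _ (borel M) R mu (ball z r) D) => //.
  exact: borel_ball.
apply: measurable_bounded_integrable => //; first exact: borel_ball.
  exact: measurable_funTS.
exists B; split; first exact: num_real.
by move=> C BC x /gB xB; apply: (le_trans xB); exact: ltW.
Qed.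

(** Cut the ball into [m] annuli about [z] of equal width. The integral of
    [phi - phi z] over each of them is 0, and [rho] is constant there up to
    [L * K / m]; so the integral of [rho * (phi - phi z)] is at most
    [L * K / m] times that of [`|phi - phi z|]. *)
Lemma radial_mean (z : M) (phi : M -> R) (rho : R -> R) (L K B : R) :
  0 <= L ->
  measurable_fun setT (phi : borel M -> R) ->
  (forall x, ball z K x -> `|phi x| <= B) ->
  measurable_fun setT ((fun x => rho (mdist x z)) : borel M -> R) ->
  (forall a b, 0 <= a -> 0 <= b -> `|rho a - rho b| <= L * `|a - b|) ->
  (forall r, 0 < r -> \int[mu]_(x in ball z r) phi x
     = phi z * fine (mu (ball z r))) ->
  \int[mu]_(x in ball z K) (rho (mdist x z) * phi x)
  = phi z * \int[mu]_(x in ball z K) rho (mdist x z).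
Proof.
move=> L0 mphi phiB mrho rhoL mvp.
have [K0|K0] := leP K 0.
  by rewrite ball_le0// !Rintegral_set0 mulr0.
pose psi x := phi x - phi z.
have B0 : 0 <= B by apply: le_trans (phiB z (ballxx z K0)).
have mpsi : measurable_fun setT (psi : borel M -> R).
  by apply: measurable_funB.
have psiB x : ball z K x -> `|psi x| <= B + B.
  move=> xK; rewrite (le_trans (ler_normB _ _))// lerD// phiB//.
  exact: ballxx.
have dB x : ball z K x -> mdist x z <= K.
  by rewrite ballEmdist/= metric_sym => /ltW.
pose Q := `|rho 0| + L * K.
have rhoB x : ball z K x -> `|rho (mdist x z)| <= Q.
  move=> /dB xK; rewrite -[rho _](subrK (rho 0)) addrC.
  rewrite (le_trans (ler_normD _ _))// lerD2l.
  apply: (le_trans (rhoL _ _ (mdist_ge0 _ _) (lexx 0))); rewrite subr0.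
  by rewrite ger0_norm ?mdist_ge0// ler_wpM2l.
have mrp (c : R) : measurable_fun setT
    ((fun x => (rho (mdist x z) - c) * psi x) : borel M -> R).
  by apply: measurable_funM => //; exact: measurable_funB.
have rpB (c : R) x : ball z K x ->
    `|(rho (mdist x z) - c) * psi x| <= (Q + `|c|) * (B + B).
  move=> xK; rewrite normrM ler_pM ?psiB//.
  by rewrite (le_trans (ler_normB _ _))// lerD2r rhoB.
have intrp c (D : set M) : D `<=` ball z K -> measurable (D : set (borel M)) ->
    mu.-integrable D (EFin \o (fun x => (rho (mdist x z) - c) * psi x)).
  by move=> DK mD; apply: (ball_integrable DK mD (mrp c) (rpB c)).
have intpsi (D : set M) : D `<=` ball z K -> measurable (D : set (borel M)) ->
    mu.-integrable D (EFin \o psi).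
  by move=> DK mD; apply: (ball_integrable DK mD mpsi psiB).
have intnpsi (D : set M) : D `<=` ball z K -> measurable (D : set (borel M)) ->
    mu.-integrable D (EFin \o (fun x => `|psi x|)).
  move=> DK mD; apply: (@ball_integrable z K (B + B)) => //.
    exact: measurableT_comp.
  by move=> x xK; rewrite normr_id psiB.
have ballS (r r' : R) : r <= r' -> ball z r `<=` ball z r'.
  by move=> rr x; rewrite !ballEmdist/= => /lt_le_trans; exact.
have psi0 r : r <= K -> \int[mu]_(x in ball z r) psi x = 0.
  move=> rK; have [r0|r0] := leP r 0; first by rewrite ball_le0// Rintegral_set0.
  have mb := borel_ball z r.
  rewrite RintegralB//.
  - by rewrite mvp// Rintegral_cst// subrr.
  - by apply: (ball_integrable (ballS _ _ rK) mb mphi phiB).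
  - apply: (@ball_integrable z K B) => //; first exact: ballS.
    by move=> x _; apply: phiB; exact: ballxx.
pose rp x := rho (mdist x z) * psi x.
have rpE : rp = (fun x => (rho (mdist x z) - 0) * psi x).
  by apply/funext => x; rewrite subr0.
have intrp0 (D : set M) : D `<=` ball z K -> measurable (D : set (borel M)) ->
    mu.-integrable D (EFin \o rp) by rewrite rpE; exact: intrp.
(* over the first [j] annuli of width [d], the errors add up to a multiple of
   [L * d] *)
have step (d : R) (j : nat) : 0 < d -> j%:R * d <= K ->
    `|\int[mu]_(x in ball z (j%:R * d)) rp x| <=
    L * d * \int[mu]_(x in ball z (j%:R * d)) `|psi x|.
  move=> d0; elim: j => [_|j IH jK].
    by rewrite mul0r ball_le0// !Rintegral_set0 normr0 mulr0.
  have jK' : j%:R * d <= K.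
    by apply: le_trans jK; rewrite ler_pM2r// ler_nat.
  pose D := ball z (j.+1%:R * d) `\` ball z (j%:R * d).
  have bE : ball z (j.+1%:R * d) = ball z (j%:R * d) `|` D.
    rewrite /D setDE setUIr setUv setIT; apply/esym/setUidr/ballS.
    by rewrite ler_pM2r// ler_nat.
  have mD : measurable (D : set (borel M)) by apply: measurableD; exact: borel_ball.
  have mb := borel_ball z (j%:R * d).
  have DK : D `<=` ball z K by move=> x [/(ballS _ _ jK)].
  have disj : [disjoint ball z (j%:R * d) & D].
    apply/disj_setPS => x [xb [_ /(_ xb)]] //.
  have bK : ball z (j%:R * d) `|` D `<=` ball z K.
    by rewrite -bE; exact: ballS.
  have mbD : measurable (ball z (j%:R * d) `|` D : set (borel M)) by exact: measurableU.
  rewrite bE Rintegral_setU//; last exact: intrp0.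
  rewrite [X in _ <= _ * X]Rintegral_setU//; last exact: intnpsi.
  have D0 : \int[mu]_(x in D) psi x = 0.
    have := psi0 _ jK; rewrite bE Rintegral_setU//; last exact: intpsi.
    by rewrite psi0// add0r.
  rewrite mulrDr (le_trans (ler_normD _ _))// lerD// ?IH//.
  have -> : \int[mu]_(x in D) rp x =
      \int[mu]_(x in D) ((rho (mdist x z) - rho (j%:R * d)) * psi x).
    transitivity (\int[mu]_(x in D)
       ((rho (mdist x z) - rho (j%:R * d)) * psi x + rho (j%:R * d) * psi x)).
      by apply: eq_Rintegral => x _; rewrite -mulrDl subrK.
    rewrite RintegralD//; [|exact: intrp|].
      by rewrite RintegralZl ?D0 ?mulr0 ?addr0//; exact: intpsi.
    by apply: integrable_mulrl => //; exact: intpsi.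
  apply: le_trans (le_normr_Rintegral _ _) _ => //; first exact: intrp.
  rewrite -RintegralZl//; last exact: intnpsi.
  apply: le_Rintegral => //.
  - apply: (@ball_integrable z K ((Q + `|rho (j%:R * d)|) * (B + B))) => //.
      by apply: measurableT_comp => //; exact: mrp.
    by move=> x xK; rewrite normr_id; exact: rpB.
  - by apply: integrable_mulrl => //; exact: intnpsi.
  move=> x [xb nxb]; rewrite normrM ler_wpM2r//.
  have jd0 : 0 <= j%:R * d by rewrite mulr_ge0// ltW.
  apply: (le_trans (rhoL _ _ (mdist_ge0 _ _) jd0)).
  rewrite ler_wpM2l// ger0_norm.
    move: xb; rewrite ballEmdist/= metric_sym -natr1 mulrDl mul1r; lra.
  rewrite subr_ge0 leNgt; apply/negP => h; apply: nxb.
  by rewrite ballEmdist/= metric_sym.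
have rp0 : \int[mu]_(x in ball z K) rp x = 0.
  apply/eqP; rewrite -normr_le0; apply/ler_addgt0Pl => eps eps0; rewrite addr0.
  set N := \int[mu]_(x in ball z K) `|psi x|.
  have N0 : 0 <= N by apply: Rintegral_ge0.
  pose m := (Num.truncn (L * K * N / eps)).+1.
  have m0 : 0 < m%:R :> R by rewrite ltr0n.
  have mK : m%:R * (K / m%:R) = K by rewrite mulrCA mulfV ?gt_eqF// mulr1.
  have := step (K / m%:R) m; rewrite mK divr_gt0// lexx => /(_ isT isT)/le_trans.
  apply; rewrite -/N (_ : L * (K / m%:R) * N = L * K * N / m%:R); last by ring.
  rewrite ler_pdivrMr// -ler_pdivrMl// mulrC.
  by rewrite ltW// truncnS_gt.
have intr : mu.-integrable (ball z K) (EFin \o (fun x => rho (mdist x z))).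
  exact: (ball_integrable _ (borel_ball z K) mrho rhoB).
transitivity (\int[mu]_(x in ball z K) (rp x + phi z * rho (mdist x z))).
  by apply: eq_Rintegral => x _; rewrite /rp /psi; ring.
rewrite RintegralD//; [|exact: borel_ball|exact: intrp0 (borel_ball _ _)|].
  by rewrite rp0 add0r RintegralZl//; exact: borel_ball.
by apply: integrable_mulrl => //; exact: borel_ball.
Qed.

End RadialMean.

Section BochnerMean.
Variables (R : realType) (M : completeMetricType R).
Variable mu : {measure set (borel M) -> \bar R}.
Hypothesis mu_ball : forall (z : M) (r : R), (mu (ball z r) < +oo)%E.
Variables (V : completeNormedModType R) (ip : V -> V -> R).
Hypothesis ipP : inner_product ip.
Variable f : M -> V.
Hypothesis f_cont : continuous f.
Hypothesis M_proper : proper_metric M.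

Lemma ip_ball_bounded (z : M) (r : R) (e : V) :
  exists B : R, forall x, ball z r x -> `|ip (f x) e| <= B.
Proof.
have [B B0 fB] := bounded_on_precompact f_cont (proper_ball_precompact z r M_proper).
exists (B * `|e|) => x xr; apply: le_trans (cauchy_schwarz ipP _ _) _.
by rewrite ler_wpM2r// fB.
Qed.

Lemma ip_ball_integrable (z : M) (r : R) (e : V) :
  mu.-integrable (ball z r) (EFin \o (fun x => ip (f x) e)).
Proof.
have [B fB] := ip_ball_bounded z r e.
apply: (ball_integrable mu_ball _ (borel_ball z r) _ fB) => //.
exact: (measurable_ip ipP f_cont).
Qed.

(** Tested against a vector, the vector integral becomes an ordinary one, and
    the mean value property becomes a statement on scalar functions. *)
Lemma bochner_ip (z : M) (r : R) (v e : V) :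
  is_bochner_integral mu (ball z r) f v ->
  \int[mu]_(x in ball z r) ip (f x) e = ip v e.
Proof.
move=> [_ [s [s0 sv]]]; set D : set (borel M) := ball z r.
have mD : measurable (D : set (borel M)) by exact: borel_ball.
have intf : mu.-integrable D (EFin \o (fun x => ip (f x) e)).
  exact: ip_ball_integrable.
have int1 n (i : 'I_(simple_size (s n))) :
    mu.-integrable D (EFin \o (\1_(simple_set i) : borel M -> R)).
  apply: (@ball_integrable _ _ _ mu_ball z r 1) => //.
    by apply: measurable_indic; exact: simple_measurable.
  by move=> x _; rewrite ger0_norm indicE ?ler_nat//; case: (_ \in _).
pose t n x := ip (simple_eval (s n) x) e.
have tE n x : t n x = \sum_i ip (simple_val i) e * \1_(simple_set (s := s n) i) x.
  by rewrite /t /simple_eval (ip_suml ipP); apply: eq_bigr => i _;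
    rewrite (ipZl ipP) mulrC.
have intt n : mu.-integrable D (EFin \o t n).
  rewrite (_ : EFin \o t n = (fun x =>
      \sum_(i <- index_enum 'I_(simple_size (s n)))
        (ip (simple_val i) e * \1_(simple_set (s := s n) i) x)%:E)%E); last first.
    by apply/funext => x; rewrite /= tE sumEFin.
  by apply: integrable_sum => // i _; exact: integrable_mulrl.
have intE n : \int[mu]_(x in D) t n x = ip (simple_integral D (s n)) e.
  rewrite /simple_integral (ip_suml ipP) /Rintegral.
  rewrite (_ : \int[mu]_(x in D) (t n x)%:E = \sum_(i <- index_enum 'I_(simple_size (s n)))
     \int[mu]_(x in D) (ip (simple_val i) e * \1_(simple_set (s := s n) i) x)%:E)%E; last first.
    rewrite -integral_sum//; last by move=> i; exact: integrable_mulrl.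
    by apply: eq_integral => x _; rewrite tE sumEFin.
  rewrite -sum_fine; last first.
    by move=> i _; apply: integrable_fin_num => //; exact: integrable_mulrl.
  apply: eq_bigr => i _; rewrite (ipZl ipP) mulrC.
  rewrite -/(Rintegral mu D _) RintegralZl//; congr (_ * _).
  by rewrite /Rintegral integral_indic//; exact: simple_measurable.
set I := \int[mu]_(x in D) ip (f x) e.
(* a positive substitute for the norm of [e], which may be 0 *)
pose k : R := `|e| + 1.
have k0 : 0 < k by rewrite ltr_wpDl.
have bound n : (`|I - ip (simple_integral D (s n)) e|%:E <=
    k%:E * \int[mu]_(x in D) `|f x - simple_eval (s n) x|%:E)%E.
  rewrite -intE -RintegralB// EFin_normr_Rintegral//; last first.
    by have := integrableB mD intf (intt n); apply: eq_integrable.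
  have mft : measurable_fun D (fun x : borel M => `|ip (f x) e - t n x|).
    apply: measurableT_comp => //; apply: measurable_funB.
      by apply: measurable_funTS; exact: (measurable_ip ipP f_cont).
    by apply/measurable_EFinP; exact: (measurable_int _ (intt n)).
  apply: le_trans (le_abse_integral _ _ _) _ => //.
    apply/measurable_EFinP; apply: measurable_funB.
      by apply: measurable_funTS; exact: (measurable_ip ipP f_cont).
    by apply/measurable_EFinP; exact: (measurable_int _ (intt n)).
  (* the constant is taken out of the measurable integrand; the comparison
     with [`|f x - simple_eval (s n) x|] comes after *)
  rewrite [leLHS](_ : _ = k%:E *
      \int[mu]_(x in D) (k^-1 * `|ip (f x) e - t n x|)%:E)%E; last first.
    rewrite -ge0_integralZl//.
    - by apply: eq_integral => x _; rewrite -EFinM mulrA mulfV ?gt_eqF// mul1r.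
    - by apply/measurable_EFinP; apply: measurable_funM.
    - by move=> x _; rewrite lee_fin mulr_ge0// invr_ge0 ltW.
    - by rewrite lee_fin ltW.
  rewrite lee_pmul2l//; apply: le_ge0_integral => x _; rewrite lee_fin.
    by rewrite mulr_ge0// invr_ge0 ltW.
  rewrite ler_pdivrMl// -(ipBl ipP) mulrC.
  apply: le_trans (cauchy_schwarz ipP _ _) _.
  by rewrite ler_wpM2l// lerDl.
have cv1 : (`|I - ip (simple_integral D (s n)) e|%:E @[n --> \oo] -->
    `|I - ip v e|%:E)%E.
  apply: cvg_EFin; first exact: nearW.
  apply: (@cvg_norm _ R^o); apply: (@cvgB _ R^o); first exact: cvg_cst.
  exact: (cvg_comp _ _ sv (@ip_continuous _ _ _ ipP e v)).
have cv2 : (k%:E * \int[mu]_(x in D) `|f x - simple_eval (s n) x|%:E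
    @[n --> \oo] --> 0)%E.
  by rewrite -(mule0 k%:E); apply: cvgeZl.
have : (`|I - ip v e|%:E <= 0)%E.
  rewrite -(cvg_lim _ cv1)// -(cvg_lim _ cv2)//; apply: lee_lim.
  - by apply/cvg_ex; eexists; exact: cv1.
  - by apply/cvg_ex; eexists; exact: cv2.
  - exact: nearW.
by rewrite lee_fin normr_le0 subr_eq0 => /eqP.
Qed.

Lemma mean_value_ip (z : M) (r : R) (e : V) : mean_value mu f -> 0 < r ->
  \int[mu]_(x in ball z r) ip (f x) e = ip (f z) e * fine (mu (ball z r)).
Proof.
move=> mv r0.
have : (0 <= mu (ball z r))%E by [].
rewrite le_eqVlt => /predU1P[mu0|mu_gt0].
  rewrite -mu0 mulr0 /Rintegral null_set_integral//.
    exact: borel_ball.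
  apply/measurable_EFinP; apply: measurable_funTS.
  exact: (measurable_ip ipP f_cont).
have [v bv ->] := mv z r r0 mu_gt0; rewrite (bochner_ip e bv) (ipZl ipP) mulrAC.
by rewrite mulVf ?mul1r// gt_eqF// fine_gt0// mu_gt0 mu_ball.
Qed.

End BochnerMean.

(** * Sums over configurations as limits *)

Section NetSums.
Variables (R : realType) (M : completeMetricType R).
Hypothesis M_proper : proper_metric M.
Variables (X : config M) (o : M).
Implicit Types (s t : seq M) (A B : set M).

Definition subpts s : Prop := forall x, (count_mem x s <= mult X x)%N.

Definition covers s B : Prop := forall x, B x -> count_mem x s = mult X x.

(** The sum of [g] over [X] as a limit along finite sub-multisets of [X] that
    exhaust the balls about [o]; listings and sums over growing balls about
    other points are special cases. *)
Definition net_sum (V : normedModType R) (g : M -> V) (v : V) : Prop :=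
  forall eps : R, 0 < eps -> exists K : nat, forall s, subpts s ->
    covers s (ball o K%:R) -> `|\sum_(x <- s) g x - v| <= eps.

Lemma subpts_pts A : precompact A -> subpts (pts X A).
Proof. by move=> cA x; rewrite count_pts//; case: ifP. Qed.

Lemma covers_pts A B : precompact A -> B `<=` A -> covers (pts X A) B.
Proof. by move=> cA BA x /BA Ax; rewrite count_pts// mem_set. Qed.

Lemma subpts_filter (p : pred M) s : subpts s -> subpts (seq.filter p s).
Proof.
move=> sX x; apply: leq_trans (sX x); rewrite count_filter.
by apply: sub_count => y /= /andP[].
Qed.

Lemma perm_pts A s : precompact A -> subpts s -> covers s A ->
  perm_eq [seq x <- s | x \in A] (pts X A).
Proof.
move=> cA sX sA; apply/allP => x _; apply/eqP => /=.
rewrite count_filter count_pts//; case: ifPn => xA.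
  rewrite -(sA x (set_mem xA)); apply: eq_count => y /=.
  have [->|//] := eqVneq y x; exact: xA.
rewrite (@eq_count _ _ pred0) ?count_pred0// => y /=.
by have [->|//] := eqVneq y x; apply/negbTE.
Qed.

Lemma big_covers (V : nmodType) A s (g : M -> V) :
  precompact A -> subpts s -> covers s A ->
  \sum_(x <- s) g x = \sum_(x <- pts X A) g x
    + \sum_(x <- [seq x <- s | x \notin A]) g x.
Proof.
move=> cA sX sA; rewrite (bigID (fun x => x \in A))/=; congr (_ + _).
  by rewrite -big_filter; apply: perm_big; exact: perm_pts.
by rewrite -big_filter.
Qed.

(** Large balls about [z] contain any given ball about [o]. *)
Lemma net_sum_balls (V : normedModType R) (g : M -> V) (v : V) (z : M) :
  net_sum g v -> \sum_(x <- pts X (ball z K%:R)) g x @[K --> \oo] --> v.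
Proof.
move=> gv; apply/cvgrPdist_le => eps eps0; have [K gK] := gv eps eps0.
pose m := (Num.truncn (mdist o z)).+1.
exists (K + m)%N => // n /= Kn; rewrite distrC; apply: gK.
  exact/subpts_pts/proper_ball_precompact.
apply: covers_pts; first exact: proper_ball_precompact.
move=> x; rewrite !ballEmdist/= => ox.
apply: (le_lt_trans (metric_triangle z o x)); rewrite metric_sym.
apply: (@lt_le_trans _ _ (K + m)%:R); last by rewrite ler_nat.
by rewrite natrD addrC ltrD// truncnS_gt.
Qed.

Lemma net_sumB (V : normedModType R) (g g' : M -> V) (v v' : V) :
  net_sum g v -> net_sum g' v' -> net_sum (fun x => g x - g' x) (v - v').
Proof.
move=> gv gv' eps eps0; have e20 : 0 < eps / 2 by rewrite divr_gt0.
have [K gK] := gv _ e20; have [K' gK'] := gv' _ e20.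
exists (maxn K K') => s sX sK; rewrite (splitr eps).
rewrite (_ : _ - _ = (\sum_(x <- s) g x - v) - (\sum_(x <- s) g' x - v'));
  last by rewrite sumrB !opprD !opprK addrACA.
apply: le_trans (ler_normB _ _) _; apply: lerD.
  apply: gK => // x ox; apply: sK; move: ox; rewrite !ballEmdist/= => /lt_le_trans; apply.
  by rewrite ler_nat leq_maxl.
apply: gK' => // x ox; apply: sK; move: ox; rewrite !ballEmdist/= => /lt_le_trans; apply.
by rewrite ler_nat leq_maxr.
Qed.

Lemma net_sumZ (V : normedModType R) (a : R) (g : M -> V) (v : V) :
  net_sum g v -> net_sum (fun x => a *: g x) (a *: v).
Proof.
move=> gv eps eps0; have a1 : 0 < `|a| + 1 by rewrite ltr_wpDl.
have [|K gK] := gv (eps / (`|a| + 1)); first by rewrite divr_gt0.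
exists K => s sX sK; rewrite -scaler_sumr -scalerBr normrZ.
have := gK s sX sK; rewrite ler_pdivlMr// => h; apply: le_trans h.
by rewrite mulrC ler_wpM2l// lerDl.
Qed.

(** The pairs [(x, i)] with [i < mult X x] form a countable set; an injection
    into the integers assigns a position to each. *)
Lemma listing_exists : exists e, listing X e.
Proof.
have cT : countable [set p : M * nat | (p.2 < mult X p.1)%N].
  apply: (@sub_countable _ _ _ ([set x | (0 < mult X x)%N] `*` [set: nat])).
    by apply: subset_card_le => p /= pX; split=> //; exact: leq_ltn_trans pX.
  by apply: countableX => //; exact: config_support_countable.
have /countable_injP[j jinj] := cT.
pose e n := if pselect (exists p : M * nat, (p.2 < mult X p.1)%N /\ j p = n)
  is left pn then Some (projT1 (cid pn)).1 else None.
have eP p : (p.2 < mult X p.1)%N -> e (j p) = Some p.1.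
  move=> pX; rewrite /e; case: pselect => [q|]; last by case; exists p.
  case: cid => q' [q'X jq'] /=; congr (Some _.1).
  by apply: jinj => //; exact: mem_set.
exists e => x; rewrite card_eq_sym; apply/card_set_bijP.
exists (fun i => j (x, i)); split.
- by move=> i /= ix; rewrite (eP (x, i)).
- move=> i k /set_mem/= ix /set_mem/= kx jik.
  have : (x, i) = (x, k) by apply: jinj => //; exact: mem_set.
  by case.
- move=> n /=; rewrite /e; case: pselect => // -[[y i] [/= yi jn]].
  by case: cid => -[y' i'] /= [y'i' <-] [<-]; exists i'.
Qed.

Definition prefix_pts (e : nat -> option M) (n : nat) : seq M :=
  pmap e (iota 0 n).

Lemma series_prefix (V : normedModType R) (g : M -> V) e n :
  series (fun k => oapp g 0 (e k)) n = \sum_(x <- prefix_pts e n) g x.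
Proof.
rewrite /series/= /prefix_pts /index_iota subn0.
elim: (iota 0 n) => [|k r IH]; first by rewrite !big_nil.
by rewrite big_cons IH/=; case: (e k) => [x|]/=; rewrite ?big_cons ?add0r.
Qed.

Lemma count_prefix e n x :
  count_mem x (prefix_pts e n) = size [seq k <- iota 0 n | e k == Some x].
Proof.
rewrite size_filter /prefix_pts; elim: (iota 0 n) => //= k r <-.
by case: (e k).
Qed.

Lemma subpts_prefix e n : listing X e -> subpts (prefix_pts e n).
Proof.
move=> eX x; rewrite count_prefix -(card_fset_set (eX x)).
have fx : finite_set [set n | e n = Some x].
  by apply/finite_setP; exists (mult X x).
apply: uniq_leq_size; first by rewrite filter_uniq// iota_uniq.
by move=> k; rewrite mem_filter => /andP[/eqP ek _]; rewrite in_fset_set//; exact: mem_set.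
Qed.

(** A precompact set contains finitely many points of [X], each listed at
    finitely many positions. *)
Lemma covers_prefix e B : listing X e -> precompact B ->
  exists n0, forall n, (n0 <= n)%N -> covers (prefix_pts e n) B.
Proof.
move=> eX cB; have fB := config_finite X cB.
have fx x : finite_set [set n | e n = Some x].
  by apply/finite_setP; exists (mult X x).
pose S := \bigcup_(x in B `&` [set x | (0 < mult X x)%N]) [set n | e n = Some x].
have fS : finite_set S by exact: bigcup_finite.
pose n0 := (\max_(k <- fset_set S) k).+1.
exists n0 => n n0n x Bx; apply/eqP; rewrite eqn_leq subpts_prefix//=.
have [->//|mx] := posnP (mult X x).
rewrite count_prefix -(card_fset_set (eX x)).
apply: uniq_leq_size; first exact: finmap.fset_uniq.
move=> k; rewrite in_fset_set// => /set_mem/= ek.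
rewrite mem_filter ek eqxx/= mem_iota add0n/=; apply: leq_trans n0n.
rewrite ltnS; have kS : k \in fset_set S.
  by rewrite in_fset_set//; apply/mem_set; exists x.
by rewrite (big_rem k)//= leq_maxl.
Qed.

Lemma net_sum_unconditional (V : normedModType R) (g : M -> V) (v : V) :
  net_sum g v -> unconditional_sum X g v.
Proof.
move=> gv; split; first exact: listing_exists.
move=> e eX; apply/cvgrPdist_le => eps eps0; have [K gK] := gv eps eps0.
have [n0 n0P] := covers_prefix eX (proper_ball_precompact o K%:R M_proper).
exists n0 => // n /= n0n; rewrite distrC series_prefix; apply: gK.
  exact: subpts_prefix.
exact: n0P.
Qed.

(** Cauchy's criterion: if sums over finite sets of far away points are small,
    the sums over balls form a Cauchy sequence, and any finite sub-multiset
    that exhausts a large ball has nearly the same sum as that ball. *)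
Lemma net_sum_exists (V : completeNormedModType R) (g : M -> V) :
  (forall eps : R, 0 < eps -> exists K : nat, forall s, subpts s ->
     (forall x, x \in s -> ~ ball o K%:R x) -> `|\sum_(x <- s) g x| <= eps) ->
  exists v, net_sum g v.
Proof.
move=> tail; pose u K := \sum_(x <- pts X (ball o K%:R)) g x.
have cb K : precompact (ball o K%:R) by exact: proper_ball_precompact.
have ballS (K K' : nat) : (K <= K')%N -> ball o K%:R `<=` ball o K'%:R.
  move=> KK x; rewrite !ballEmdist/= => /lt_le_trans; apply.
  by rewrite ler_nat.
have uP (eps : R) : 0 < eps -> exists K : nat, forall s, subpts s ->
    covers s (ball o K%:R) -> `|\sum_(x <- s) g x - u K| <= eps.
  move=> eps0; have [K KP] := tail eps eps0; exists K => s sX sK.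
  rewrite (big_covers g (cb K) sX sK) /u addrC addKr; apply: KP.
    exact: subpts_filter.
  by move=> x; rewrite mem_filter => /andP[+ _]; rewrite notin_setE.
have cu : cvg (u @ \oo).
  apply/cauchy_cvgP/cauchy_exP => eps eps0.
  have e20 : 0 < eps / 2 by rewrite divr_gt0.
  have [K KP] := uP _ e20; exists (u K), K => // n /= Kn.
  rewrite -ball_normE/= distrC; apply: (@le_lt_trans _ _ (eps / 2)); last first.
    by rewrite [ltRHS](splitr eps) ltrDl.
  apply: KP; first exact: subpts_pts.
  by apply: covers_pts => //; exact: ballS.
exists (limn u) => eps eps0.
have e30 : 0 < eps / 2 / 2 by rewrite !divr_gt0.
have e20 : 0 < eps / 2 by rewrite divr_gt0.
have [K KP] := uP _ e30.
have /cvgrPdist_le/(_ _ e20)[N _ NP] := cu.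
exists K => s sX sK.
pose n := maxn K N.
have un : `|u n - u K| <= eps / 2 / 2.
  apply: KP; first exact: subpts_pts.
  by apply: covers_pts => //; apply: ballS; rewrite leq_maxl.
have ln : `|limn u - u n| <= eps / 2 by apply: NP; rewrite /= leq_maxr.
have sn := KP s sX sK.
rewrite [X in `|X|](_ : _ = (\sum_(x <- s) g x - u K) - (u n - u K) -
  (limn u - u n)); last first.
  rewrite !opprB [_ + (u K - u n)]addrA subrK addrA subrK//.
apply: le_trans (ler_normB _ _) _; rewrite (splitr eps) lerD//.
by apply: le_trans (ler_normB _ _) _; rewrite (splitr (eps / 2)) lerD.
Qed.

End NetSums.

(** * Domination in the positive cone *)

Section Cone.
Variables (R : realType) (M : completeMetricType R).
Hypothesis M_proper : proper_metric M.
Variables (X : config M) (o : M).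
Variables (H : completeNormedModType R) (le : rel H) (C : R).
Hypothesis le_order : partially_ordered_space le.
Hypothesis C_gt0 : 0 < C.
Hypothesis le_norm : forall u1 u2 u3, le u1 u2 -> le u2 u3 ->
  `|u2| <= C * Num.max `|u1| `|u3|.
Variable f : M -> H.
Hypothesis f_ge0 : forall x, le 0 (f x).
Implicit Types (s t : seq M) (a b : M -> R).

Lemma cone_normD u v : le 0 u -> le 0 v -> `|u| <= C * `|u + v|.
Proof.
move=> u0 v0; have [_ _ _ _ leD] := le_order.
have uuv : le u (u + v) by have := leD _ _ u v0; rewrite add0r addrC.
by have := le_norm u0 uuv; rewrite normr0 max_r.
Qed.

Lemma cone_sum_ge0 s a : (forall x, 0 <= a x) -> le 0 (\sum_(x <- s) a x *: f x).
Proof.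
move=> a0; have [lexx _ le_tr leZ leD] := le_order.
elim: s => [|x s IH]; first by rewrite big_nil.
rewrite big_cons; apply: (le_tr _ _ _ IH).
have := leD _ _ (\sum_(x <- s) a x *: f x) (leZ _ _ _ (a0 x) (f_ge0 x)).
by rewrite scaler0 add0r.
Qed.

(** What separates the left sum from the right one, the excess of weight as
    well as the additional points, lies in the cone, so [cone_normD]
    applies. *)
Lemma dominated_sum s t a b : (forall x, (count_mem x s <= count_mem x t)%N) ->
  (forall x, 0 <= a x) -> (forall x, x \in s -> a x <= b x) ->
  (forall x, 0 <= b x) ->
  `|\sum_(x <- s) a x *: f x| <= C * `|\sum_(x <- t) b x *: f x|.
Proof.
move=> st a0 ab b0; have /count_subseqP[s' /perm_to_subseq[u tE] ss'] := st.
rewrite (perm_big _ tE) big_cat/= (perm_big _ ss')/=.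
pose c x := if x \in s then b x - a x else 0.
have c0 x : 0 <= c x by rewrite /c; case: ifPn => // /ab; rewrite subr_ge0.
rewrite [X in _ <= _ * `|X + _|](_ : _ = \sum_(x <- s') a x *: f x
    + \sum_(x <- s') c x *: f x); last first.
  rewrite -big_split/= big_seq [RHS]big_seq; apply: eq_bigr => x.
  rewrite -(perm_mem ss') /c => ->.
  by rewrite scalerBl addrC subrK.
rewrite -addrA; apply: cone_normD; first exact: cone_sum_ge0.
have [_ _ le_tr _ leD] := le_order.
apply: le_tr (cone_sum_ge0 u b0) _.
have := leD _ _ (\sum_(x <- u) b x *: f x) (cone_sum_ge0 s' c0).
by rewrite add0r.
Qed.

(** The order relation between partial sums may be lost in the limit, because
    the cone need not be closed; the inequality between norms is not. *)
Lemma net_sum_dominated a b (A B : H) :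
  (forall x, 0 <= a x <= b x) ->
  net_sum X o (fun x => a x *: f x) A -> net_sum X o (fun x => b x *: f x) B ->
  `|A| <= C * `|B|.
Proof.
move=> ab nA nB.
have cA : `|\sum_(x <- pts X (ball o K%:R)) a x *: f x| @[K --> \oo] --> `|A|.
  by apply: cvg_norm; exact: (net_sum_balls M_proper o nA).
have cB : `|\sum_(x <- pts X (ball o K%:R)) b x *: f x| @[K --> \oo] --> `|B|.
  by apply: cvg_norm; exact: (net_sum_balls M_proper o nB).
have cCB : C * `|\sum_(x <- pts X (ball o K%:R)) b x *: f x| @[K --> \oo]
    --> C * `|B| by apply: cvgM => //; exact: cvg_cst.
apply: (ler_cvg_to cA cCB); apply: nearW => K; apply: dominated_sum => // x.
- by have /andP[] := ab x.
- by have /andP[] := ab x.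
- by have /andP[a0 /(le_trans a0)] := ab x.
Qed.

Variable h : R.
Hypothesis h_ge0 : 0 <= h.

(** Almost all configurations have this property, and it does not depend on
    the exponent or the base point of the weights. *)
Definition tame : Prop := forall t : R, h < t -> exists c : R, forall k : nat,
  `|\sum_(x <- pts X (annulus o k)) f x| <= c * expR (t * k%:R).

Lemma annulus_precompact k : precompact (annulus o k).
Proof.
rewrite precompactE.
have := proper_ball_precompact o k.+1%:R M_proper; rewrite precompactE => cb.
apply: (subclosed_compact _ cb); first exact: closed_closure.
apply: closure_subset => x [_]; rewrite ballEmdist/= metric_sym//.
Qed.

(** The weights of the points of the [k]-th annulus are at most
    [expR (t * mdist o z) * expR (- t * k%:R)], a constant. With these larger
    weights, and with all points of the annuli from the [K]-th up to the last
    one that [s] meets, the sum is a combination of annular sums, bounded by a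
    geometric series. *)
Lemma tame_tail (t : R) (z : M) : tame -> h < t ->
  forall eps : R, 0 < eps -> exists K : nat, forall s, subpts X s ->
     (forall x, x \in s -> ~ ball o K%:R x) ->
     `|\sum_(x <- s) weight t z x *: f x| <= eps.
Proof.
move=> Xf ht eps eps0.
have t_gt0 : 0 < t by exact: le_lt_trans ht.
(* a rate between [h] and [t], which leaves the ratio [q < 1] *)
pose t' := (h + t) / 2.
have ht' : h < t' by rewrite /t'; lra.
have t't : t' < t by rewrite /t'; lra.
have [c0 Sc0] := Xf t' ht'.
pose c := `|c0|.
have Sc k : `|\sum_(x <- pts X (annulus o k)) f x| <= c * expR (t' * k%:R).
  by rewrite (le_trans (Sc0 k))// ler_wpM2r ?expR_ge0// ler_norm.
pose q := expR (t' - t).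
have q0 : 0 <= q by exact: expR_ge0.
have q1 : q < 1 by rewrite expR_lt1 subr_lt0.
pose D := C * (expR (t * mdist o z) * c) / (1 - q).
have D0 : 0 <= D.
  by rewrite /D divr_ge0 ?mulr_ge0 ?expR_ge0 ?normr_ge0 ?(ltW C_gt0)// subr_ge0 ltW.
have [K KP] : exists K : nat, D * q ^+ K <= eps.
  have cv : D * q ^+ n @[n --> \oo] --> D * 0.
    by apply: cvgM; [exact: cvg_cst|apply: cvg_expr; rewrite ger0_norm].
  move: cv; rewrite mulr0 => /cvgrPdist_le/(_ _ eps0)[K _ /(_ K (leqnn K))].
  rewrite sub0r normrN ger0_norm; [by exists K|exact: mulr_ge0 D0 (exprn_ge0 _ q0)].
exists K => s sX sK.
pose fl x := Num.truncn (mdist x o).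
pose n := (\max_(x <- s) (fl x).+1)%N.
pose T := flatten [seq pts X (annulus o k) | k <- iota K n].
pose b x := expR (t * mdist o z) * expR (- t * (fl x)%:R).
have flP x : annulus o (fl x) x.
  by have /andP[] := truncn_itv (mdist_ge0 x o).
have sT x : (count_mem x s <= count_mem x T)%N.
  have [xs|xs] := boolP (x \in s); last by rewrite (count_memPn xs).
  rewrite /T count_flatten -map_comp sumnE big_map/=.
  apply: leq_trans (sX x) _.
  have kin : fl x \in iota K n.
    rewrite mem_iota; apply/andP; split.
      have := sK x xs; rewrite ballEmdist/= metric_sym => /negP; rewrite -leNgt.
      by rewrite /fl truncn_ge_nat ?mdist_ge0.
    by rewrite /n (big_rem x)//= (leq_trans _ (leq_addl _ _))// leq_maxl.
  rewrite (big_rem (fl x))//= count_pts; last exact: annulus_precompact.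
  by rewrite mem_set// leq_addr.
have w0 x : 0 <= weight t z x by exact: expR_ge0.
have wb x : weight t z x <= b x.
  rewrite /weight /b -expRD ler_expR.
  have : (fl x)%:R <= mdist x o by case: (flP x).
  have := metric_triangle x z o; rewrite (metric_sym z o) => h1 h2.
  have : t * (fl x)%:R <= t * (mdist x z + mdist o z).
    by rewrite ler_pM2l// (le_trans h2).
  by rewrite mulrDr; lra.
have b0 x : 0 <= b x by exact: le_trans (wb x).
apply: le_trans (dominated_sum sT w0 (fun x _ => wb x) b0) _.
apply: le_trans KP.
have -> : \sum_(x <- T) b x *: f x = \sum_(k <- iota K n)
    (expR (t * mdist o z) * expR (- t * k%:R)) *:
       \sum_(x <- pts X (annulus o k)) f x.
  rewrite /T big_flatten/= big_map; apply: eq_bigr => k _.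
  rewrite scaler_sumr big_seq [RHS]big_seq; apply: eq_bigr => x.
  move=> /(mem_pts (annulus_precompact k))[k1 k2]; congr (_ *: _); rewrite /b.
  suff -> : fl x = k by [].
  by apply/eqP; rewrite /fl truncn_eq ?mdist_ge0// k1.
rewrite /D -!mulrA ler_pM2l// !mulrA.
apply: le_trans (ler_norm_sum _ _ _) _.
apply: (@le_trans _ _ (\sum_(k <- iota K n) (expR (t * mdist o z) * c) * q ^+ k)).
  apply: ler_sum => k _; rewrite normrZ ger0_norm ?mulr_ge0 ?expR_ge0//.
  rewrite -!mulrA ler_wpM2l ?expR_ge0//.
  apply: le_trans (ler_wpM2l (expR_ge0 _) (Sc k)) _.
  rewrite mulrCA ler_wpM2l ?normr_ge0// -expRD /q -expRM_natr le_eqVlt; apply/orP; left.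
  by apply/eqP; congr expR; ring.
rewrite -mulr_sumr -[leRHS]mulrA ler_wpM2l ?mulr_ge0 ?expR_ge0 ?normr_ge0//.
by rewrite [leRHS]mulrC; apply: geometric_tail; rewrite q0.
Qed.

Lemma tame_net_sum (t : R) (z : M) : tame -> h < t ->
  exists v, net_sum X o (fun x => weight t z x *: f x) v.
Proof. by move=> Xf ht; apply: net_sum_exists => //; exact: tame_tail. Qed.

End Cone.

(** * Volume growth and exponential weights *)

Section Growth.
Variable R : realType.

Lemma subexp_nat_bounded (g : nat -> R) (a : R) : subexp_nat g -> 0 < a ->
  exists2 B : R, 0 <= B & forall k, g k <= B * expR (a * k%:R).
Proof.
move=> sg a0; have cv := sg a a0.
have [B [_ HB]] : bounded_fun (fun k => g k * expR (- a * k%:R)).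
  by apply: (@cvg_seq_bounded R R^o); apply/cvg_ex; exists 0.
exists (`|B| + 1) => // k; have := HB (`|B| + 1); rewrite (le_lt_trans (ler_norm _)) ?ltrDl//.
move=> /(_ isT k I)/= /(le_trans (ler_norm _)).
by rewrite mulNr expRN ler_pdivrMr ?expR_gt0.
Qed.

Lemma subexp_restrict_nat (g : R -> R) : subexp (EFin \o g) ->
  subexp_nat (fun k => g k%:R).
Proof.
move=> sg a a0; have := sg a a0 => /(cvg_comp _ _ (@cvgr_idn R)) h.
exact: (@fine_cvg _ _ _ _ (fun k : nat => (g k%:R * expR (- a * k%:R))%:E)).
Qed.

(** A lower limit [+oo] is covered too: the infimum over a neighborhood of
    [+oo] is at most a value of [g], hence finite. *)
Lemma limf_einf_pinfty_gt0 (g : R -> R) :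
  (0 < limf_einf (EFin \o g) +oo%R)%E ->
  exists2 c : R, 0 < c & \forall r \near +oo%R, c <= g r.
Proof.
rewrite limf_einfE => /ereal_sup_gt[_ [V Voo <-]] infV.
have [v Vv] : V !=set0 by exact: (@filter_ex _ (pinfty_nbhs R)).
have infle x : V x -> (ereal_inf [set (EFin \o g) x | x in V] <= (g x)%:E)%E.
  by move=> Vx; apply: ereal_inf_lbound; exists x.
case: (ereal_inf _) infV infle => [c c0 infle|_ infle|//].
- by exists c => //; apply: filterS Voo => x /infle; rewrite lee_fin.
- by have := infle v Vv.
Qed.

End Growth.

Section Mass.
Variables (R : realType) (M : completeMetricType R).
Variables (mu : {measure set (borel M) -> \bar R}) (o : M) (h : R).
Hypothesis h_gt0 : 0 < h.

Definition ball_growth : Prop := forall t : R, h < t ->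
  exists2 c : R, 0 <= c &
    forall k : nat, (mu (ball o k%:R) <= (c * expR (t * k%:R))%:E)%E.

(** The factor [U] is absorbed by the gap between [h] and [t]. *)
Lemma volume_growth_upper : volume_growth mu o h -> ball_growth.
Proof.
move=> [L [U [[_ _ _ [_ sU] _] muLU]]] t ht.
have th0 : 0 < t - h by rewrite subr_gt0.
have [B B0 UB] := subexp_nat_bounded (subexp_restrict_nat sU) th0.
exists B => // -[|k]; first by rewrite ball_le0// measure0 lee_fin mulr_ge0 ?expR_ge0.
have [_ mU] := muLU k.+1%:R (ltr0Sn _ _); apply: (le_trans mU).
rewrite lee_fin; apply: le_trans (ler_wpM2r (expR_ge0 _) (UB k.+1)) _.
rewrite -mulrA ler_wpM2l// -expRD le_eqVlt; apply/orP; left; apply/eqP.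
by congr expR; ring.
Qed.

Lemma volume_growth_lower : volume_growth mu o h ->
  exists2 c : R, 0 < c & exists N : nat, forall k : nat, (N <= k)%N ->
    ((c * expR (h * k%:R))%:E <= mu (ball o k%:R))%E.
Proof.
move=> [L [U [[_ _ Linf _ _] muLU]]].
have [c c0 [r0 [_ Lc]]] := limf_einf_pinfty_gt0 Linf; exists c => //.
pose N := (Num.truncn `|r0|).+1; exists N => k Nk.
have rk : r0 < k%:R.
  apply: (le_lt_trans (ler_norm _)); apply: (@lt_le_trans _ _ N%:R).
    exact: truncnS_gt.
  by rewrite ler_nat.
have k0 : 0 < k%:R :> R by rewrite ltr0n (leq_trans _ Nk).
have [mL _] := muLU k%:R k0; apply: le_trans mL.
by rewrite lee_fin (mulrC h) ler_wpM2r ?expR_ge0 ?Lc.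
Qed.

Hypothesis mu_growth : ball_growth.

Lemma ball_finite (z : M) (r : R) : (mu (ball z r) < +oo)%E.
Proof.
have [|c c0 mc] := mu_growth (t := h + 1); first by rewrite ltrDl.
pose k := (Num.truncn (mdist o z + r)).+1.
apply: (@le_lt_trans _ _ (mu (ball o k%:R))); last first.
  by apply: le_lt_trans (mc k) _; rewrite ltry.
apply: le_measure; [by apply: mem_set; exact: borel_ball..|].
move=> x; rewrite !ballEmdist/= => zx.
apply: (le_lt_trans (metric_triangle o z x)).
apply: (@lt_trans _ _ (mdist o z + r)); first by rewrite ltrD2l.
exact: truncnS_gt.
Qed.

Lemma weight_ge0 (s : R) (z x : M) : 0 <= weight s z x.
Proof. exact: expR_ge0. Qed.

Lemma weight_le1 (s : R) (z x : M) : 0 <= s -> weight s z x <= 1.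
Proof.
by move=> s0; rewrite /weight expR_le1 mulNr oppr_le0 mulr_ge0// mdist_ge0.
Qed.

Lemma weight_sqr (s : R) (z x : M) : weight s z x ^+ 2 = weight (2 * s) z x.
Proof. by rewrite /weight -expRM_natr; congr expR; ring. Qed.

Lemma weight_shift (s : R) (z z' x : M) : 0 <= s ->
  weight s z x <= expR (s * mdist z z') * weight s z' x.
Proof.
move=> s0; rewrite /weight -expRD ler_expR.
have := metric_triangle x z z' => h1.
have : s * mdist x z' <= s * (mdist x z + mdist z z') by rewrite ler_wpM2l.
by rewrite mulrDr; lra.
Qed.

Lemma measurable_weight (s : R) (z : M) :
  measurable_fun setT (weight s z : borel M -> R).
Proof.
apply: measurableT_comp; first exact: measurable_expR.
apply: measurable_funM => //; apply: borel_continuous; exact: mdist_continuous.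
Qed.

Lemma integral_balls_cvg (z : M) (g : M -> \bar R) :
  (forall x, 0 <= g x)%E -> measurable_fun setT (g : borel M -> \bar R) ->
  (\int[mu]_(x in ball z K%:R) g x @[K --> \oo] --> \int[mu]_x g x)%E.
Proof.
move=> g0 mg.
have UE : \bigcup_(K : nat) (ball z K%:R : set (borel M)) = setT.
  apply/seteqP; split=> // x _; exists (Num.truncn (mdist z x)).+1 => //.
  by rewrite ballEmdist/= truncnS_gt.
rewrite -[in X in _ --> X]UE; apply: ge0_nondecreasing_set_cvg_integral => //.
- move=> m n mn; apply/subsetPset => x; rewrite !ballEmdist/= => /lt_le_trans.
  by apply; rewrite ler_nat.
- by move=> K; exact: borel_ball.
- by move=> K; exact: measurable_funTS.
Qed.

Lemma measurable_annulus k : measurable (annulus o k : set (borel M)).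
Proof.
rewrite (_ : annulus o k = ball o k.+1%:R `\` ball o k%:R).
  by apply: measurableD; exact: borel_ball.
apply/seteqP; split=> x; rewrite /annulus/= !ballEmdist/= (metric_sym o x).
  by move=> [kx xk]; split=> //; apply/negP; rewrite -leNgt.
by move=> [xk /negP]; rewrite -leNgt.
Qed.

Lemma ballS_annulus k : ball o k.+1%:R = ball o k%:R `|` annulus o k.
Proof.
apply/seteqP; split=> x; rewrite /annulus !ballEmdist/= (metric_sym o x).
  by move=> xk; case: (ltP (mdist x o) k%:R) => ?; [left|right].
by move=> [/lt_trans|[]//]; apply; rewrite ltr_nat.
Qed.

Lemma ball_annulus_disj k : [disjoint ball o k%:R & annulus o k].
Proof.
apply/disj_setPS => x [] + [kx _]; rewrite ballEmdist/= (metric_sym o x).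
by rewrite ltNge kx.
Qed.

Lemma annulus_ball k : annulus o k `<=` ball o k.+1%:R.
Proof. by rewrite ballS_annulus; exact: subsetUr. Qed.

(** The [k]-th annulus has measure at most [c * expR (t * k.+1%:R)] for some
    [t < s], so the integral about [o] is bounded by a geometric series; a
    change of base point costs a constant factor. *)
Lemma mass_lty (s : R) (z : M) : h < s -> (\int[mu]_x (weight s z x)%:E < +oo)%E.
Proof.
move=> hs; have s0 : 0 <= s by rewrite ltW// (lt_trans h_gt0).
have mw z' : measurable_fun setT ((fun x => (weight s z' x)%:E) : borel M -> \bar R).
  by apply/measurable_EFinP; exact: measurable_weight.
pose t := (h + s) / 2.
have [|c c0 mc] := mu_growth (t := t); first by rewrite /t; lra.
pose q := expR (t - s).
have q01 : 0 <= q < 1 by rewrite expR_ge0/= expR_lt1 /t; lra.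
have ballb K : (\int[mu]_(x in ball o K%:R) (weight s o x)%:E <=
    (c * expR t * \sum_(k <- iota 0 K) q ^+ k)%:E)%E.
  elim: K => [|K IH].
    by rewrite ball_le0// integral_set0 big_nil mulr0.
  rewrite ballS_annulus ge0_integral_setU//;
    [|exact: borel_ball|exact: measurable_annulus|exact: measurable_funTS
     |by move=> x _; rewrite lee_fin weight_ge0|exact: ball_annulus_disj].
  rewrite -addn1 iotaD big_cat/= big_cons big_nil addr0 add0n mulrDr EFinD.
  apply: leeD => //.
  apply: (@le_trans _ _ (\int[mu]_(x in annulus o K) (expR (- s * K%:R))%:E)%E).
    apply: le_ge0_integral => x [Kx _]; first by rewrite lee_fin weight_ge0.
    by rewrite lee_fin /weight ler_expR ler_wnM2l// oppr_le0.
  rewrite integral_cst//; last exact: measurable_annulus.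
  apply: (@le_trans _ _ ((expR (- s * K%:R))%:E * mu (ball o K.+1%:R))%E).
    rewrite lee_wpmul2l ?lee_fin ?expR_ge0// le_measure//.
    - by apply: mem_set; exact: measurable_annulus.
    - by apply: mem_set; exact: borel_ball.
    - exact: annulus_ball.
  apply: (le_trans (lee_wpmul2l _ (mc K.+1))); first by rewrite lee_fin expR_ge0.
  rewrite -EFinM lee_fin mulrCA -mulrA ler_wpM2l// -expRD /q -expRM_natr -expRD.
  by rewrite le_eqVlt; apply/orP; left; apply/eqP; congr expR; rewrite -natr1; ring.
have ofin : (\int[mu]_x (weight s o x)%:E < +oo)%E.
  apply: (@le_lt_trans _ _ (c * expR t * (q ^+ 0 / (1 - q)))%:E); last by rewrite ltry.
  have w0 x : (0 <= (weight s o x)%:E)%E by rewrite lee_fin weight_ge0.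
  have cv := integral_balls_cvg o w0 (mw o).
  rewrite -(cvg_lim _ cv)//; apply: lime_le; first by apply/cvg_ex; eexists; exact: cv.
  apply: nearW => K; apply: (le_trans (ballb K)); rewrite lee_fin.
  by rewrite ler_wpM2l ?mulr_ge0 ?expR_ge0// geometric_tail.
apply: (@le_lt_trans _ _ (\int[mu]_x ((expR (s * mdist z o))%:E * (weight s o x)%:E))%E).
  apply: le_ge0_integral => x _; rewrite lee_fin ?weight_ge0//.
  by rewrite weight_shift.
rewrite ge0_integralZl ?lee_fin ?expR_ge0//; last first.
  by move=> x _; rewrite lee_fin weight_ge0.
by rewrite lte_mul_pinfty ?lee_fin ?expR_ge0.
Qed.

Definition mass (s : R) (z : M) : R := \int[mu]_x weight s z x.

Lemma massE (s : R) (z : M) : h < s ->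
  (\int[mu]_x (weight s z x)%:E = (mass s z)%:E)%E.
Proof.
move=> hs; rewrite /mass fineK// ge0_fin_numE ?mass_lty//.
by apply: integral_ge0 => x _; rewrite lee_fin weight_ge0.
Qed.

Lemma mass_gt0 (s : R) (z : M) (r : R) : h < s -> (0 < mu (ball z r))%E ->
  0 < mass s z.
Proof.
move=> hs mr; have s0 : 0 <= s by rewrite ltW// (lt_trans h_gt0).
rewrite -lte_fin -massE//.
apply: (@lt_le_trans _ _ (\int[mu]_(x in ball z r) (expR (- s * r))%:E)%E).
  rewrite integral_cst//; last exact: borel_ball.
  by rewrite mule_gt0// lte_fin expR_gt0.
apply: (@le_trans _ _ (\int[mu]_(x in ball z r) (weight s z x)%:E)%E).
  apply: le_ge0_integral => x; first by rewrite lee_fin expR_ge0.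
  rewrite ballEmdist/= metric_sym => /ltW xr.
  by rewrite lee_fin /weight ler_expR ler_wnM2l// oppr_le0.
apply: ge0_subset_integral => //; first exact: borel_ball.
  by apply/measurable_EFinP; exact: measurable_weight.
by move=> x _; rewrite lee_fin weight_ge0.
Qed.

Lemma mass_shift (s : R) (z z' : M) : h < s ->
  mass s z <= expR (s * mdist z z') * mass s z'.
Proof.
move=> hs; have s0 : 0 <= s by rewrite ltW// (lt_trans h_gt0).
rewrite -lee_fin EFinM -!massE// -ge0_integralZl//.
- apply: le_ge0_integral => x _; rewrite lee_fin ?weight_ge0//.
  by rewrite weight_shift.
- by apply/measurable_EFinP; exact: measurable_weight.
- by move=> x _; rewrite lee_fin weight_ge0.
Qed.

Lemma ball_mass_cvg (s : R) (z : M) : h < s ->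
  \int[mu]_(x in ball z K%:R) weight s z x @[K --> \oo] --> mass s z.
Proof.
move=> hs; apply: fine_cvg; rewrite -massE//; apply: integral_balls_cvg.
  by move=> x; rewrite lee_fin weight_ge0.
by apply/measurable_EFinP; exact: measurable_weight.
Qed.

End Mass.

(** * Almost sure growth and almost sure limits *)

Section AlmostSure.
Variables (R : realType) (M : completeMetricType R).
Hypothesis M_proper : proper_metric M.
Variables (mu : {measure set (borel M) -> \bar R}) (o : M) (h : R).
Hypothesis h_gt0 : 0 < h.
Hypothesis mu_growth : ball_growth mu o h.
Variable Pi : probability (Conf M) R.
Hypothesis Pi_intensity : first_intensity Pi mu.
Variable C : R.
Hypotheses (C_gt0 : 0 < C) (PiC : variance_bound mu Pi C).
Variables (V : completeNormedModType R) (ip : V -> V -> R).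
Hypothesis ipP : inner_product ip.
Variable f : M -> V.
Hypothesis f_cont : continuous f.
Hypothesis f_mean : forall (z : M) (r : R) (e : V), 0 < r ->
  \int[mu]_(x in ball z r) ip (f x) e = ip (f z) e * fine (mu (ball z r)).

Let mu_ball (z : M) (r : R) : (mu (ball z r) < +oo)%E.
Proof. exact: (ball_finite mu_growth). Qed.

Let mu_annulus k : (mu (annulus o k) < +oo)%E.
Proof.
apply: le_lt_trans (mu_ball o k.+1%:R); apply: le_measure.
- by apply: mem_set; exact: measurable_annulus.
- by apply: mem_set; exact: borel_ball.
- exact: annulus_ball.
Qed.

Let int_ip (z : M) (r : R) (e : V) :
  mu.-integrable (ball z r) (EFin \o (fun x => ip (f x) e)).
Proof. exact: ip_ball_integrable. Qed.

(** An annulus is a difference of two balls about [o]. *)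
Lemma annulus_mean k e : \int[mu]_(x in annulus o k) ip (f x) e =
  ip (f o) e * fine (mu (annulus o k)).
Proof.
have mb r : measurable (ball o r : set (borel M)) by exact: borel_ball.
have ma : measurable (annulus o k : set (borel M)) by exact: measurable_annulus.
have muE : fine (mu (ball o k.+1%:R)) =
    fine (mu (ball o k%:R)) + fine (mu (annulus o k)).
  rewrite ballS_annulus measureU//; last first.
    by apply/eqP; rewrite -disj_set2E; exact: ball_annulus_disj.
  by rewrite fineD // ge0_fin_numE ?measure_ge0 //; [exact: mu_ball|exact: mu_annulus].
have := f_mean o e (ltr0Sn _ k); rewrite muE mulrDr ballS_annulus Rintegral_setU//.
- have -> : \int[mu]_(x in ball o k%:R) ip (f x) e =
      ip (f o) e * fine (mu (ball o k%:R)).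
    have [->|k0] := eqVneq k 0%N.
      by rewrite ball_le0// Rintegral_set0 measure0 mulr0.
    by apply: f_mean; rewrite ltr0n lt0n.
  by move/addrI.
- by rewrite -ballS_annulus; exact: int_ip.
- exact: ball_annulus_disj.
Qed.

Definition annulus_deviation k : Conf M -> V :=
  deviation f (annulus o k) \1_(annulus o k) (fine (mu (annulus o k))) o.

Lemma annulus_deviationE k X : annulus_deviation k X =
  \sum_(x <- pts X (annulus o k)) f x - fine (mu (annulus o k)) *: f o.
Proof.
rewrite /annulus_deviation /deviation; congr (_ - _).
rewrite big_seq [RHS]big_seq; apply: eq_bigr => x.
move=> /(mem_pts (annulus_precompact M_proper o k)) xk.
by rewrite indicE mem_set// scale1r.
Qed.

Let annulus_hyps k e :
  fine (\int[mu]_(x in annulus o k) (\1_(annulus o k) x * ip (f x) e)%:E) =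
  fine (mu (annulus o k)) * ip (f o) e.
Proof.
rewrite mulrC -annulus_mean; apply: eq_Rintegral => x xk.
by rewrite indicE xk mul1r.
Qed.

Let measurable_ind (A : set M) : measurable (A : set (borel M)) ->
  measurable_fun setT (\1_A : borel M -> R).
Proof. by move=> mA; exact: measurable_indic. Qed.

Let ind1 (A : set M) x : `|\1_A x : R| <= 1.
Proof. by rewrite indicE; case: (_ \in _); rewrite ?normr1 ?normr0. Qed.

Let ind0 (A : set M) x : ~ A x -> \1_A x = 0 :> R.
Proof. by move=> nA; rewrite indicE memNset. Qed.

Lemma measurable_annulus_deviation k :
  measurable_fun setT (fun X => `|annulus_deviation k X| ^+ 2).
Proof.
apply: (measurable_deviation Pi_intensity ipP f_cont M_proper _ _ _ (annulus_hyps k)).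
- exact: measurable_annulus.
- exact: annulus_precompact.
- by apply: measurable_ind; exact: measurable_annulus.
Qed.

Lemma annulus_variance k :
  (\int[Pi]_X (`|annulus_deviation k X| ^+ 2)%:E <=
   C%:E * \int[mu]_(x in annulus o k) (`|f x| ^+ 2)%:E)%E.
Proof.
have ma : measurable (annulus o k : set (borel M)) by exact: measurable_annulus.
apply: le_trans (vector_variance Pi_intensity C_gt0 PiC ipP f_cont M_proper ma
  (annulus_precompact M_proper o k) (mu_annulus k) (measurable_ind ma)
  (@ind1 _) (@ind0 _) (annulus_hyps k)) _.
rewrite lee_pmul2l//; apply: le_ge0_integral => x xk.
  by rewrite lee_fin mulr_ge0 ?sqr_ge0.
by rewrite indicE mem_set// expr1n mul1r.
Qed.

Definition square_growth : Prop := forall t : R, h < t ->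
  exists2 c : R, 0 <= c & forall k : nat,
    (\int[mu]_(x in annulus o k) (`|f x| ^+ 2)%:E <= (c * expR (2 * t * k%:R))%:E)%E.

(** By [annulus_variance], the mean squares of the deviations on the annuli
    are of order at most [expR (2 * t' * k%:R)] for every [t' > h]. So they are
    summable after division by [expR (2 * t j * k%:R)], for [t j] decreasing to
    [h]. The means are controlled by the volume growth. *)
Lemma tame_ae : square_growth -> {ae Pi, forall X : Conf M, tame X o f h}.
Proof.
move=> f_growth.
pose t j : R := h + j.+1%:R^-1.
pose G j k X := expR (- (2 * t j) * k%:R) * `|annulus_deviation k X| ^+ 2.
have G0 j k X : 0 <= G j k X by rewrite mulr_ge0 ?expR_ge0 ?sqr_ge0.
have mG j k : measurable_fun setT (G j k).
  by apply: measurable_funM => //; exact: measurable_annulus_deviation.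
have aeG j : {ae Pi, forall X, (G j k X)%:E @[k --> \oo] --> 0%E}.
  apply: ae_cvg0_summable.
  - by move=> k; apply/measurable_EFinP; exact: mG.
  - by move=> k X; rewrite lee_fin.
  (* a rate between [h] and [t j], which leaves the ratio [q < 1] *)
  pose t' := h + j.+1%:R^-1 / 2.
  have j0 : 0 < j.+1%:R^-1 :> R by rewrite invr_gt0.
  have [|c c0 fc] := f_growth t'; first by rewrite /t' ltrDl divr_gt0.
  pose q := expR (2 * t' - 2 * t j).
  have q01 : 0 <= q < 1.
    rewrite expR_ge0/= expR_lt1 /t' /t.
    by move: (j.+1%:R^-1) j0 => d j0; lra.
  apply: le_lt_trans (geometric_eseries_lty (mulr_ge0 (ltW C_gt0) c0) q01).
  apply: lee_nneseries => [k _ _|k _].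
    by apply: integral_ge0 => X _; rewrite lee_fin.
  under eq_integral do rewrite EFinM.
  rewrite ge0_integralZl ?lee_fin ?expR_ge0//; last first.
    by apply/measurable_EFinP; exact: measurable_annulus_deviation.
  apply: (@le_trans _ _ ((expR (- (2 * t j) * k%:R))%:E *
      (C%:E * (c * expR (2 * t' * k%:R))%:E))%E).
    apply: lee_wpmul2l; first by rewrite lee_fin expR_ge0.
    apply: le_trans (annulus_variance k) _.
    by apply: lee_wpmul2l => //; rewrite lee_fin ltW.
  rewrite -!EFinM lee_fin /q -expRM_natr le_eqVlt; apply/orP; left; apply/eqP.
  rewrite (_ : (2 * t' - 2 * t j) * k%:R =
    - (2 * t j) * k%:R + 2 * t' * k%:R); last by ring.
  by rewrite expRD; ring.
have := ae_foralln aeG; apply: filterS => X XG s hs.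
have [j js] : exists j : nat, j.+1%:R^-1 < s - h.
  exists (Num.truncn (s - h)^-1); have sh0 : 0 < s - h by rewrite subr_gt0.
  by rewrite -[ltRHS]invrK ltf_pV2 ?posrE ?invr_gt0// truncnS_gt.
have ts : t j <= s by rewrite /t -lerBrDl ltW.
have Gc : G j k X @[k --> \oo] --> 0 by exact: (fine_cvg (XG j)).
have [B [_ HB]] : bounded_fun (fun k => G j k X).
  by apply: (@cvg_seq_bounded R R^o); apply/cvg_ex; exists 0.
pose B1 := `|B| + 1.
have GB k : G j k X <= B1.
  apply: (le_trans (ler_norm _)); apply: (HB B1) => //.
  by rewrite (le_lt_trans (ler_norm _))// ltrDl.
have [c c0 mc] := mu_growth hs.
exists ((1 + B1) + c * expR s * `|f o|) => k.
have -> : \sum_(x <- pts X (annulus o k)) f x =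
    annulus_deviation k X + fine (mu (annulus o k)) *: f o.
  by rewrite annulus_deviationE subrK.
apply: (le_trans (ler_normD _ _)); rewrite mulrDl lerD//.
  have e0 : 0 < expR (- t j * k%:R) by exact: expR_gt0.
  apply: (@le_trans _ _ ((1 + B1) * expR (t j * k%:R))); last first.
    by rewrite ler_wpM2l ?ler_expR ?ler_wpM2r// addr_ge0// addr_ge0.
  rewrite -ler_pdivrMr ?expR_gt0// -expRN.
  set y := _ * _.
  have : y ^+ 2 <= B1.
    apply: le_trans (GB k); rewrite /G /y exprMn mulrC -expRM_natr.
    rewrite le_eqVlt; apply/orP; left; apply/eqP; congr (expR _ * _); ring.
  (* a bound on the square bounds [y], as [y <= 1 + y ^+ 2] *)
  by have := sqr_ge0 (y - 1); rewrite sqrrB1 -mulr_natr => h1 h2; nra.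
rewrite normrZ ger0_norm ?fine_ge0// [leRHS]mulrAC ler_wpM2r//.
rewrite -lee_fin fineK ?ge0_fin_numE//.
apply: (@le_trans _ _ (mu (ball o k.+1%:R))).
  apply: le_measure.
  - by apply: mem_set; exact: measurable_annulus.
  - by apply: mem_set; exact: borel_ball.
  - exact: annulus_ball.
apply: (le_trans (mc k.+1)); rewrite lee_fin -mulrA ler_wpM2l// -expRD.
by rewrite ler_expR -natr1 mulrDr mulr1 addrC.
Qed.

Variable z : M.

(** The weight is cut off at radius [K] to have bounded support. *)
Definition ball_deviation (s : R) (K : nat) : Conf M -> V :=
  deviation f (ball z K%:R) (fun x => weight s z x * \1_(ball z K%:R) x)
    (\int[mu]_(x in ball z K%:R) weight s z x) z.

Lemma ball_deviationE s K X : ball_deviation s K X =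
  \sum_(x <- pts X (ball z K%:R)) weight s z x *: f x
  - (\int[mu]_(x in ball z K%:R) weight s z x) *: f z.
Proof.
rewrite /ball_deviation /deviation; congr (_ - _).
rewrite big_seq [RHS]big_seq; apply: eq_bigr => x.
move=> /(mem_pts (proper_ball_precompact z _ M_proper)) xk.
by rewrite indicE mem_set// mulr1.
Qed.

Lemma ball_radial_mean (s : R) (K : nat) e : 0 <= s ->
  \int[mu]_(x in ball z K%:R) (weight s z x * ip (f x) e) =
  (\int[mu]_(x in ball z K%:R) weight s z x) * ip (f z) e.
Proof.
move=> s0; have [B fB] := ip_ball_bounded ipP f_cont M_proper z K%:R e.
rewrite mulrC.
apply: (radial_mean mu_ball (phi := fun x => ip (f x) e)
  (rho := fun a => expR (- s * a)) s0 _ fB).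
- exact: (measurable_ip ipP f_cont).
- exact: measurable_weight.
- by move=> a b; exact: expR_lipschitz.
- by move=> r r0; exact: f_mean.
Qed.

Let ball_hyps s K e : 0 <= s ->
  fine (\int[mu]_(x in ball z K%:R)
     (weight s z x * \1_(ball z K%:R) x * ip (f x) e)%:E) =
  (\int[mu]_(x in ball z K%:R) weight s z x) * ip (f z) e.
Proof.
move=> s0; rewrite -ball_radial_mean//; apply: eq_Rintegral => x xk.
by rewrite indicE xk mulr1.
Qed.

Let mbw s K : measurable_fun setT
  ((fun x => weight s z x * \1_(ball z K%:R) x) : borel M -> R).
Proof.
apply: measurable_funM; first exact: measurable_weight.
by apply: measurable_ind; exact: borel_ball.
Qed.

Lemma measurable_ball_deviation s K : 0 <= s ->
  measurable_fun setT (fun X => `|ball_deviation s K X| ^+ 2).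
Proof.
move=> s0.
apply: (measurable_deviation Pi_intensity ipP f_cont M_proper _ _ _
  (fun e => ball_hyps K e s0)).
- exact: borel_ball.
- exact: proper_ball_precompact.
- exact: mbw.
Qed.

Lemma ball_variance s K : 0 <= s ->
  (\int[Pi]_X (`|ball_deviation s K X| ^+ 2)%:E <=
   C%:E * \int[mu]_x (weight (2 * s) z x * `|f x| ^+ 2)%:E)%E.
Proof.
move=> s0.
have mb : measurable (ball z K%:R : set (borel M)) by exact: borel_ball.
have w1 x : `|weight s z x * \1_(ball z K%:R) x| <= 1.
  rewrite normrM -[leRHS]mulr1 ler_pM//.
  by rewrite ger0_norm ?weight_ge0// weight_le1.
have w0 x : ~ ball z K%:R x -> weight s z x * \1_(ball z K%:R) x = 0.
  by move=> /ind0 ->; rewrite mulr0.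
apply: le_trans (vector_variance Pi_intensity C_gt0 PiC ipP f_cont M_proper mb
  (proper_ball_precompact z _ M_proper) (mu_ball z _) (mbw s K)
  w1 w0 (fun e => ball_hyps K e s0)) _.
rewrite lee_pmul2l//.
apply: (@le_trans _ _ (\int[mu]_(x in ball z K%:R)
    (weight (2 * s) z x * `|f x| ^+ 2)%:E)%E).
  apply: le_ge0_integral => x xk; first by rewrite lee_fin mulr_ge0 ?sqr_ge0.
  by rewrite indicE mem_set// mulr1 weight_sqr.
apply: ge0_subset_integral => //.
  apply/measurable_EFinP; apply: measurable_funM; first exact: measurable_weight.
  by apply: measurable_funX; exact: measurable_normf.
by move=> x _; rewrite lee_fin mulr_ge0 ?sqr_ge0 ?weight_ge0.
Qed.

(** The lower limit [G n] of the square deviations, as the cutoff radius grows,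
    is measurable, and it is the square deviation of the full sum as soon as
    that sum converges. By Fatou's lemma its integral is bounded as in
    [ball_variance], so the sum over [n] of the normalized [G n] is finite
    almost everywhere. *)
Lemma ratio_limit_ae (s : nat -> R) : (forall n, h < s n) ->
  (forall n, 0 < mass mu (s n) z) ->
  (\sum_(0 <= n <oo) ((mass mu (s n) z ^- 2)%:E *
     \int[mu]_x (weight (2 * s n) z x * `|f x| ^+ 2)%:E) < +oo)%E ->
  {ae Pi, forall X : Conf M, forall N : nat -> V,
     (forall n, net_sum X o (fun x => weight (s n) z x *: f x) (N n)) ->
     (mass mu (s n) z)^-1 *: N n @[n --> \oo] --> f z}.
Proof.
move=> hs mass0 sum_lty.
have s0 n : 0 <= s n by rewrite ltW// (lt_trans h_gt0).
pose G n X := limn_einf (fun K => (`|ball_deviation (s n) K X| ^+ 2)%:E).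
have mdev n K : measurable_fun setT (fun X => (`|ball_deviation (s n) K X| ^+ 2)%:E).
  by apply/measurable_EFinP; exact: measurable_ball_deviation.
have dev0 n K X : (0 <= (`|ball_deviation (s n) K X| ^+ 2)%:E)%E.
  by rewrite lee_fin sqr_ge0.
have mG n : measurable_fun setT (G n) by exact: measurable_limn_einf.
have G0 n X : (0 <= G n X)%E.
  rewrite /G limn_einf_lim; apply: lime_ge; first exact: is_cvg_einfs.
  by apply: nearW => K; apply: le_ereal_inf_tmp => _ [m _ <-]; exact: dev0.
have intG n : (\int[Pi]_X G n X <=
    C%:E * \int[mu]_x (weight (2 * s n) z x * `|f x| ^+ 2)%:E)%E.
  apply: fatou_bound => //.
  by move=> K; exact: ball_variance.
have m2 n : 0 <= mass mu (s n) z ^- 2 by rewrite invr_ge0 exprn_ge0// ltW.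
have aeG : {ae Pi, forall X, ((mass mu (s n) z ^- 2)%:E * G n X)%E @[n --> \oo] --> 0%E}.
  apply: ae_cvg0_summable.
  - by move=> n; exact: measurable_funeM.
  - by move=> n X; rewrite mule_ge0// lee_fin.
  apply: (@le_lt_trans _ _ (C%:E * \sum_(0 <= n <oo) ((mass mu (s n) z ^- 2)%:E *
     \int[mu]_x (weight (2 * s n) z x * `|f x| ^+ 2)%:E))%E); last first.
    by rewrite lte_mul_pinfty// lee_fin ltW.
  rewrite -nneseriesZl; last first.
    move=> n _; rewrite mule_ge0 ?lee_fin//; apply: integral_ge0 => x _.
    by rewrite lee_fin mulr_ge0 ?weight_ge0 ?sqr_ge0.
  apply: lee_nneseries => [n _ _|n _].
    by apply: integral_ge0 => X _; rewrite mule_ge0 ?lee_fin.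
  rewrite ge0_integralZl ?lee_fin//.
  by rewrite muleCA; apply: lee_wpmul2l; rewrite ?lee_fin.
move: aeG; apply: filterS => X XG N XN.
have GE n : G n X = (`|N n - mass mu (s n) z *: f z| ^+ 2)%:E.
  apply: (cvg_limn_einf_sup _).1; apply: cvg_EFin; first exact: nearW.
  rewrite expr2; under eq_fun do rewrite expr2.
  have nc : `|ball_deviation (s n) K X| @[K --> \oo] --> `|N n - mass mu (s n) z *: f z|.
    apply: cvg_norm; under eq_fun do rewrite ball_deviationE.
    apply: cvgB; first exact: (net_sum_balls M_proper z (XN n)).
    apply: cvgZr_tmp; exact: (ball_mass_cvg h_gt0 mu_growth).
  exact: cvgM.
pose y n := `|(mass mu (s n) z)^-1 *: N n - f z|.
have yE n : ((mass mu (s n) z ^- 2)%:E * G n X = (y n ^+ 2)%:E)%E.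
  rewrite GE -EFinM; congr (_%:E); rewrite /y.
  have -> : (mass mu (s n) z)^-1 *: N n - f z =
      (mass mu (s n) z)^-1 *: (N n - mass mu (s n) z *: f z).
    by rewrite scalerBr scalerA mulVf ?scale1r// gt_eqF.
  by rewrite normrZ exprMn -normrX exprVn ger0_norm.
have y2 : y n ^+ 2 @[n --> \oo] --> 0.
  by have := XG; under eq_fun do rewrite yE; move=> h1; exact: (fine_cvg h1).
apply/cvgrPdist_lt => eps eps0.
have e20 : 0 < eps ^+ 2 by rewrite exprn_gt0.
have /cvgrPdist_lt/(_ _ e20) := y2.
apply: filterS => n; rewrite sub0r normrN ger0_norm ?sqr_ge0// => yn.
by rewrite distrC -/(y n) -(@ltr_pXn2r _ 2)// ?nnegrE ?normr_ge0// ltW.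
Qed.

End AlmostSure.

(** * Comparison of base points and of functions *)

Section ScalarLine.
Variables (R : realType).

(** The denominators are sums of the constant function 1 with values in the
    real line, to which the results on [f] apply with this inner product and
    with the usual order. *)
Lemma mulr_inner_product : inner_product (fun x y : R^o => (x : R) * y : R).
Proof.
split=> [a u v w|u v|u]; first by rewrite mulrDl -mulrA.
  by rewrite mulrC.
by rewrite -normrX ger0_norm ?sqr_ge0// expr2.
Qed.

Lemma real_line_ordered : partially_ordered_space (fun x y : R^o => (x : R) <= y).
Proof.
split=> [x|x y xy|y x z|a x y a0 xy|x y z xy] //.
- by apply/eqP; rewrite eq_le.
- exact: le_trans.
- exact: ler_wpM2l.
- by rewrite lerD2r.
Qed.

Lemma real_line_norm (u1 u2 u3 : R^o) : (u1 : R) <= u2 -> (u2 : R) <= u3 ->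
  `|u2| <= 1 * Num.max `|u1| `|u3|.
Proof.
move=> u12 u23; rewrite mul1r le_max.
have [u20|/ltW u20] := leP 0 (u2 : R).
  by rewrite [X in _ || (_ <= X)]ger0_norm ?(le_trans u20)// (ger0_norm u20) u23 orbT.
by rewrite [X in (_ <= X) || _]ler0_norm ?(le_trans u12)// (ler0_norm u20) lerN2 u12.
Qed.

End ScalarLine.

Section Comparison.
Variables (R : realType) (M : completeMetricType R).
Variables (mu : {measure set (borel M) -> \bar R}) (o : M) (h : R).
Hypothesis h_gt0 : 0 < h.
Hypothesis mu_growth : ball_growth mu o h.

Definition weighted_energy (V : normedModType R) (g : M -> V) (s : R) (z : M) : \bar R :=
  (\int[mu]_x (weight (2 * s) z x * `|g x| ^+ 2)%:E)%E.

(** Up to the factor [C], a bound on the sum over [n] of the mean square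
    deviations of the numerators at [z], relative to the total weights. *)
Definition summable_at (V : normedModType R) (g : M -> V) (s : nat -> R) (z : M) : Prop :=
  (\sum_(0 <= n <oo) ((mass mu (s n) z ^- 2)%:E * weighted_energy g (s n) z) < +oo)%E.

Lemma weighted_energy_ge0 (V : normedModType R) (g : M -> V) s z :
  (0 <= weighted_energy g s z)%E.
Proof.
by apply: integral_ge0 => x _; rewrite lee_fin mulr_ge0 ?weight_ge0 ?sqr_ge0.
Qed.

Lemma measurable_energy (V : normedModType R) (g : M -> V) s z : continuous g ->
  measurable_fun setT ((fun x => weight s z x * `|g x| ^+ 2) : borel M -> R).
Proof.
move=> cg; apply: measurable_funM; first exact: measurable_weight.
by apply: measurable_funX; exact: measurable_normf.
Qed.

Lemma weighted_energy_shift (V : normedModType R) (g : M -> V) s z z' :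
  continuous g -> 0 <= s ->
  (weighted_energy g s z <= (expR (2 * s * mdist z z'))%:E * weighted_energy g s z')%E.
Proof.
move=> cg s0; rewrite /weighted_energy -ge0_integralZl ?lee_fin ?expR_ge0//.
- apply: le_ge0_integral => x _.
    by rewrite lee_fin mulr_ge0 ?weight_ge0 ?sqr_ge0.
  by rewrite -EFinM lee_fin [leRHS]mulrA ler_wpM2r ?sqr_ge0// weight_shift// mulr_ge0.
- by apply/measurable_EFinP; exact: measurable_energy.
- by move=> x _; rewrite lee_fin mulr_ge0 ?weight_ge0 ?sqr_ge0.
Qed.

(** A change of base point multiplies the weights by at most
    [expR (s n * mdist z z')], and the exponents are bounded. *)
Lemma summable_at_shift (V : normedModType R) (g : M -> V) (s : nat -> R) (S : R) z z' :
  continuous g -> (forall n, h < s n) -> (forall n, s n <= S) ->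
  (forall n, 0 < mass mu (s n) z) -> (forall n, 0 < mass mu (s n) z') ->
  summable_at g s z' -> summable_at g s z.
Proof.
move=> cg hs sS mz mz' sum'.
have s0 n : 0 <= s n by rewrite ltW// (lt_trans h_gt0).
have S0 : 0 <= S by exact: le_trans (sS 0%N).
pose d := mdist z z'; have d0 : 0 <= d by exact: mdist_ge0.
pose k := expR (4 * S * d).
apply: (@le_lt_trans _ _ (k%:E * \sum_(0 <= n <oo)
   ((mass mu (s n) z' ^- 2)%:E * weighted_energy g (s n) z'))%E); last first.
  by rewrite lte_mul_pinfty// lee_fin expR_ge0.
have m2 n x : (0 <= (mass mu (s n) x ^- 2)%:E)%E.
  by rewrite lee_fin invr_ge0 sqr_ge0.
rewrite -nneseriesZl; last by move=> n _; rewrite mule_ge0 ?weighted_energy_ge0.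
apply: lee_nneseries => [n _ _|n _]; first by rewrite mule_ge0 ?weighted_energy_ge0.
apply: le_trans (lee_wpmul2l (m2 n z) (weighted_energy_shift z z' cg (s0 n))) _.
rewrite !muleA; apply: lee_wpmul2r; first exact: weighted_energy_ge0.
rewrite -!EFinM lee_fin.
have mle : (mass mu (s n) z)^-1 <= expR (s n * d) * (mass mu (s n) z')^-1.
  rewrite ler_pdivlMr// mulrC ler_pdivrMr//.
  by rewrite /d metric_sym; exact: (mass_shift h_gt0 mu_growth).
have mle2 : mass mu (s n) z ^- 2 <= expR (2 * s n * d) * mass mu (s n) z' ^- 2.
  have -> : expR (2 * s n * d) = expR (s n * d) ^+ 2.
    by rewrite -expRM_natr; congr expR; ring.
  rewrite -!exprVn -exprMn.
  by rewrite ler_pXn2r ?nnegrE ?mulr_ge0 ?expR_ge0 ?invr_ge0// ltW.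
apply: le_trans (ler_wpM2r (expR_ge0 _) mle2) _.
rewrite mulrAC -expRD ler_wpM2r ?invr_ge0 ?sqr_ge0//.
rewrite ler_expR /d -!mulrA -mulrDr.
have : s n * d <= S * d by rewrite ler_wpM2r.
by rewrite /d; lra.
Qed.

End Comparison.

Section Nonvanishing.
Variables (R : realType) (M : completeMetricType R).
Hypothesis M_proper : proper_metric M.
Variables (mu : {measure set (borel M) -> \bar R}) (o : M) (h : R).
Hypothesis h_gt0 : 0 < h.
Hypothesis mu_growth : ball_growth mu o h.
Variables (V : completeNormedModType R) (ip : V -> V -> R).
Hypothesis ipP : inner_product ip.
Variable f : M -> V.
Hypothesis f_cont : continuous f.
Hypothesis f_mean : forall (z : M) (r : R) (e : V), 0 < r ->
  \int[mu]_(x in ball z r) ip (f x) e = ip (f z) e * fine (mu (ball z r)).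

(** By the mean value property at [z], the weighted integral of
    [ip (f x) (f z)] is [`|f z| ^+ 2] times the total weight, while the
    integrand is at most half of [`|f x| ^+ 2 + `|f z| ^+ 2]. *)
Lemma weighted_energy_lower (s : R) (z : M) : h < s ->
  ((`|f z| ^+ 2)%:E * weighted_energy mu (fun=> 1%R : R^o) s z
   <= weighted_energy mu f s z)%E.
Proof.
move=> hs; have s0 : 0 <= 2 * s by rewrite mulr_ge0// ltW// (lt_trans h_gt0).
have hs2 : h < 2 * s by lra.
have mu_ball := ball_finite mu_growth.
have -> : weighted_energy mu (fun=> 1%R : R^o) s z = (mass mu (2 * s) z)%:E.
  rewrite -(massE h_gt0 mu_growth)//; apply: eq_integral => x _.
  by rewrite normr1 expr1n mulr1.
have cv : (`|f z| ^+ 2 * \int[mu]_(x in ball z K%:R) weight (2 * s) z x)%:E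
    @[K --> \oo] --> (`|f z| ^+ 2 * mass mu (2 * s) z)%:E.
  apply: cvg_EFin; first exact: nearW.
  apply: cvgM; first exact: cvg_cst.
  exact: (ball_mass_cvg h_gt0 mu_growth).
rewrite -EFinM -(cvg_lim _ cv)//; apply: lime_le.
  by apply/cvg_ex; eexists; exact: cv.
apply: nearW => K; set aK := Rintegral _ _ _.
have [B B0 fB] := bounded_on_precompact f_cont (proper_ball_precompact z K%:R M_proper).
have mb := borel_ball z K%:R.
have intw : mu.-integrable (ball z K%:R) (EFin \o weight (2 * s) z).
  apply: (@ball_integrable _ _ _ mu_ball z K%:R (1)) => //.
    exact: measurable_weight.
  by move=> x _; rewrite ger0_norm ?weight_ge0// weight_le1.
have intwf : mu.-integrable (ball z K%:R)
    (EFin \o (fun x => weight (2 * s) z x * `|f x| ^+ 2)).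
  apply: (@ball_integrable _ _ _ mu_ball z K%:R (1 * B ^+ 2)) => //.
    exact: measurable_energy.
  move=> x xK; rewrite normrM ler_pM//.
    by rewrite ger0_norm ?weight_ge0// weight_le1.
  by rewrite normrX normr_id ler_pXn2r ?nnegrE ?fB// ltW.
have intwip : mu.-integrable (ball z K%:R)
    (EFin \o (fun x => weight (2 * s) z x * ip (f x) (f z))).
  apply: (@ball_integrable _ _ _ mu_ball z K%:R (1 * (B * `|f z|))) => //.
    apply: measurable_funM; first exact: measurable_weight.
    exact: (measurable_ip ipP f_cont).
  move=> x xK; rewrite normrM ler_pM//.
    by rewrite ger0_norm ?weight_ge0// weight_le1.
  by apply: le_trans (cauchy_schwarz ipP _ _) _; rewrite ler_wpM2r// fB.
have h1 := ball_radial_mean M_proper mu_growth ipP f_cont f_mean z K (f z) s0.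
have [_ _ ipN] := ipP.
rewrite -ipN -/aK [RHS]mulrC in h1.
have h2 : \int[mu]_(x in ball z K%:R) (weight (2 * s) z x * ip (f x) (f z)) <=
   \int[mu]_(x in ball z K%:R) (2^-1 * (weight (2 * s) z x * `|f x| ^+ 2)
     + (2^-1 * `|f z| ^+ 2) * weight (2 * s) z x).
  apply: le_Rintegral => //.
    have i1 := integrable_mulrl 2^-1 mb intwf.
    have i2 := integrable_mulrl (2^-1 * `|f z| ^+ 2) mb intw.
    by have := integrableD mb i1 i2; apply: eq_integrable.
  move=> x _; have w0 := weight_ge0 (2 * s) z x.
  have := normB_sqr ipP (f x) (f z); have := sqr_ge0 `|f x - f z|.
  set a := `|f x| ^+ 2; set b := `|f z| ^+ 2; set c := `|_| ^+ 2.
  by move=> c0 cE; nra.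
rewrite h1 RintegralD// in h2; [|exact: integrable_mulrl|exact: integrable_mulrl].
rewrite !RintegralZl// -/aK in h2.
apply: (@le_trans _ _ (\int[mu]_(x in ball z K%:R)
    (weight (2 * s) z x * `|f x| ^+ 2)%:E)%E); last first.
  apply: ge0_subset_integral => //.
    by apply/measurable_EFinP; exact: measurable_energy.
  by move=> x _; rewrite lee_fin mulr_ge0 ?weight_ge0 ?sqr_ge0.
rewrite -[leRHS]fineK; last exact: (integrable_fin_num mb intwf).
by rewrite lee_fin -/(Rintegral _ _ _); lra.
Qed.

End Nonvanishing.

(** * Nonempty configurations and all base points *)

Section Nonempty.
Variables (R : realType) (M : completeMetricType R).
Hypothesis M_proper : proper_metric M.
Variables (mu : {measure set (borel M) -> \bar R}) (o : M) (h : R).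
Hypothesis h_gt0 : 0 < h.
Hypothesis mu_growth : ball_growth mu o h.
Variable Pi : probability (Conf M) R.
Hypothesis Pi_intensity : first_intensity Pi mu.
Variable C : R.
Hypotheses (C_gt0 : 0 < C) (PiC : variance_bound mu Pi C).

(** The number of points in the ball of radius [k] has a variance at most [C]
    times its mean, and the mean grows exponentially; so the quotient of the
    number by its mean tends to 1 almost surely. *)
Lemma nonempty_ae (c : R) (N : nat) : 0 < c ->
  (forall k : nat, (N <= k)%N -> ((c * expR (h * k%:R))%:E <= mu (ball o k%:R))%E) ->
  {ae Pi, forall X : Conf M, exists x, (0 < mult X x)%N}.
Proof.
move=> c0 low.
have mu_ball := ball_finite mu_growth.
pose B k : set M := ball o (k + N)%:R.
have mB k : measurable (B k : set (borel M)) by exact: borel_ball.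
have cB k : precompact (B k) by exact: proper_ball_precompact.
pose a k := fine (mu (B k)).
have muE k : (mu (B k) = (a k)%:E)%E by rewrite /a fineK ?ge0_fin_numE//; exact: mu_ball.
have q1 : expR (- h) < 1 by rewrite expR_lt1 oppr_lt0.
have a_low k : c * expR (h * k%:R) <= a k.
  rewrite -lee_fin -muE; apply: le_trans (low _ (leq_addl k N)).
  by rewrite lee_fin ler_pM2l// ler_expR ler_pM2l// ler_nat leq_addr.
have a_gt0 k : 0 < a k.
  by apply: lt_le_trans (a_low k); rewrite mulr_gt0 ?expR_gt0.
pose D k (X : Conf M) := \sum_(x <- pts X (B k)) (\1_(B k) x : R) - a k.
have mind k : measurable_fun setT (\1_(B k) : borel M -> R) by exact: measurable_indic.
have mD k : measurable_fun setT (D k).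
  rewrite /D; apply: measurable_funB; last exact: measurable_cst.
  exact: (measurable_sum_pts Pi_intensity (mB k) (cB k) (mind k)).
have intD k : (\int[Pi]_X (D k X ^+ 2)%:E <= (C * a k)%:E)%E.
  have ind1 x : `|\1_(B k) x : R| <= 1.
    by rewrite indicE; case: (_ \in _); rewrite ?normr1 ?normr0.
  have ind0 x : ~ B k x -> \1_(B k) x = 0 :> R.
    by move=> nA; rewrite indicE memNset.
  have ak : a k = fine (\int[mu]_(x in B k) (\1_(B k) x)%:E)%E.
    by rewrite integral_indic// setIid.
  rewrite /D ak; apply: le_trans (PiC (mB k) (cB k) (mu_ball _ _) (mind k) ind1 ind0) _.
  rewrite -ak EFinM -muE lee_pmul2l//.
  rewrite -[leRHS]mul1e -integral_cst//; apply: le_ge0_integral => x xB.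
    by rewrite lee_fin sqr_ge0.
  by rewrite lee_fin indicE mem_set// expr1n.
have aeG : {ae Pi, forall X, (a k ^- 2 * D k X ^+ 2)%:E @[k --> \oo] --> 0%E}.
  apply: ae_cvg0_summable.
  - move=> k; apply/measurable_EFinP; apply: measurable_funM => //.
    exact: measurable_funX.
  - by move=> k X; rewrite lee_fin mulr_ge0 ?invr_ge0 ?sqr_ge0.
  have A0 : 0 <= C / c by rewrite divr_ge0// ltW.
  have q01 : 0 <= expR (- h) < 1 by rewrite expR_ge0.
  apply: le_lt_trans (geometric_eseries_lty A0 q01).
  apply: lee_nneseries => [k _ _|k _].
    by apply: integral_ge0 => X _; rewrite lee_fin mulr_ge0 ?invr_ge0 ?sqr_ge0.
  under eq_integral do rewrite EFinM.
  rewrite ge0_integralZl; [|by []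
    |by apply/measurable_EFinP; exact: measurable_funX
    |by move=> X _; rewrite lee_fin sqr_ge0
    |by rewrite lee_fin invr_ge0 sqr_ge0].
  apply: (@le_trans _ _ ((a k ^- 2)%:E * (C * a k)%:E)%E).
    by apply: lee_wpmul2l => //; rewrite lee_fin invr_ge0 sqr_ge0.
  rewrite -EFinM lee_fin expr2 invfM.
  rewrite (_ : _ * (C * a k) = C * (a k)^-1); last by field; rewrite gt_eqF.
  rewrite -mulrA ler_pM2l// -expRM_natr mulNr expRN -invfM.
  by rewrite lef_pV2 ?posrE ?mulr_gt0 ?expR_gt0.
move: aeG; apply: filterS => X XG; apply: contrapT => X0.
have D1 k : (a k ^- 2 * D k X ^+ 2)%:E = 1%E.
  have p0 : pts X (B k) = [::].
    case E : (pts X (B k)) => [//|x r]; exfalso; apply: X0; exists x.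
    have : (0 < count_mem x (pts X (B k)))%N by rewrite E /= eqxx.
    by rewrite count_pts//; case: ifP.
  by rewrite /D p0 big_nil sub0r sqrrN mulVf// expf_neq0// gt_eqF.
move: XG; under eq_fun do rewrite D1.
by move=> /cvg_lim => /(_ (@ereal_hausdorff R))/eqP; rewrite lim_cst// onee_eq0.
Qed.

End Nonempty.

Section Extension.
Variables (R : realType) (M : completeMetricType R).
Hypothesis M_proper : proper_metric M.
Variables (X : config M) (o : M) (h : R).
Hypothesis h_ge0 : 0 <= h.
Variables (H : completeNormedModType R) (le : rel H) (C : R).
Hypothesis le_order : partially_ordered_space le.
Hypothesis C_gt0 : 0 < C.
Hypothesis le_norm : forall u1 u2 u3, le u1 u2 -> le u2 u3 ->
  `|u2| <= C * Num.max `|u1| `|u3|.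
Variable f : M -> H.
Hypothesis f_cont : continuous f.
Hypothesis f_ge0 : forall x, le 0 (f x).
Variables (s : nat -> R) (S : R).
Hypotheses (hs : forall n, h < s n) (sS : forall n, s n <= S).

Definition numerators (z : M) (N : nat -> H) : Prop :=
  forall n, net_sum X o (fun x => weight (s n) z x *: f x) (N n).

Definition denominators (z : M) (D : nat -> R) : Prop :=
  forall n, net_sum X o (fun x => weight (s n) z x *: (1 : R^o)) (D n : R^o).

(** A single point of the configuration bounds the sum from below. *)
Lemma denominator_gt0 (t : R) (z x0 : M) (d : R^o) : (0 < mult X x0)%N ->
  net_sum X o (fun x => weight t z x *: (1 : R^o)) d -> 0 < (d : R).
Proof.
move=> x0X dX; have w0 : 0 < weight t z x0 by exact: expR_gt0.
have [|K KP] := dX (weight t z x0 / 2); first by rewrite divr_gt0.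
pose m := maxn K (Num.truncn (mdist o x0)).+1.
have cb : precompact (ball o m%:R) by exact: proper_ball_precompact.
have := KP (pts X (ball o m%:R)) (subpts_pts _ cb).
have sub : ball o K%:R `<=` ball o m%:R.
  move=> x; rewrite !ballEmdist/= => /lt_le_trans; apply.
  by rewrite ler_nat leq_maxl.
move=> /(_ (covers_pts X cb sub)).
have x0in : x0 \in pts X (ball o m%:R).
  rewrite -has_pred1 has_count count_pts// mem_set//.
  rewrite ballEmdist/=; apply: lt_le_trans (truncnS_gt _) _.
  by rewrite ler_nat leq_maxr.
rewrite (big_rem x0)//= ler_norml => /andP[_].
set r := \sum_(_ <- _) _.
have r0 : 0 <= (r : R).
  by apply: sumr_ge0 => x _; rewrite /= mulr_ge0// weight_ge0.
rewrite /= [_ *: _]mulr1 => hh.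
have : (weight t z x0 + r - d : R) <= weight t z x0 / 2 by exact: hh.
by lra.
Qed.

(** Let [w] be the weight about [z] and [w'] the one about [y], scaled by
    [expR (- s n * d)], where [d] is the distance of [z] and [y]. Then
    [w - w'] lies between 0 and [eta * w'], and [net_sum_dominated] bounds the
    differences of the numerators and of the denominators by [eta] times those
    for [w'], up to the factor [C] for the numerators. *)
Lemma ratio_perturbation (z y : M) (x0 : M) (n : nat) (N N' : H) (D D' : R) :
  (0 < mult X x0)%N ->
  net_sum X o (fun x => weight (s n) z x *: f x) N ->
  net_sum X o (fun x => weight (s n) z x *: (1 : R^o)) (D : R^o) ->
  net_sum X o (fun x => weight (s n) y x *: f x) N' ->
  net_sum X o (fun x => weight (s n) y x *: (1 : R^o)) (D' : R^o) ->
  `|D^-1 *: N - D'^-1 *: N'| <=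
    (C + 1) * (expR (2 * S * mdist z y) - 1) * `|D'^-1 *: N'|.
Proof.
move=> x0X nN nD nN' nD'.
have D0 : 0 < D by exact: denominator_gt0 x0X nD.
have D'0 : 0 < D' by exact: denominator_gt0 x0X nD'.
have s0 : 0 <= s n by rewrite ltW// (le_lt_trans h_ge0).
pose d := mdist z y; have d0 : 0 <= d by exact: mdist_ge0.
pose k := expR (- (s n * d)).
have k0 : 0 < k by exact: expR_gt0.
pose eta := expR (2 * S * d) - 1.
have eta0 : 0 <= eta.
  by rewrite subr_ge0 -[leLHS]expR0 ler_expR !mulr_ge0// (le_trans s0).
pose w x := weight (s n) z x.
pose w' x := k * weight (s n) y x.
have w'0 x : 0 <= w' x by apply: mulr_ge0; [exact: ltW|exact: weight_ge0].
have w'w x : w' x <= w x.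
  rewrite /w' /k expRN mulrC ler_pdivrMr ?expR_gt0// mulrC /d metric_sym.
  exact: weight_shift.
have ww' x : w x - w' x <= eta * w' x.
  rewrite lerBlDr -{2}(mul1r (w' x)) -mulrDl subrK.
  apply: le_trans (weight_shift z y x s0) _.
  rewrite /w' mulrA ler_wpM2r ?weight_ge0// /k -expRD ler_expR -/d.
  have : s n * d <= S * d by rewrite ler_wpM2r.
  by lra.
have scaled (V : normedModType R) (g : M -> V) v :
    net_sum X o (fun x => weight (s n) y x *: g x) v ->
    net_sum X o (fun x => w' x *: g x) (k *: v).
  move=> gv; have := net_sumZ k gv.
  by under eq_fun do rewrite scalerA.
have diff (V : normedModType R) (g : M -> V) u v :
    net_sum X o (fun x => w x *: g x) u -> net_sum X o (fun x => w' x *: g x) v ->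
    net_sum X o (fun x => (w x - w' x) *: g x) (u - v).
  by move=> gu gv; have := net_sumB gu gv; under eq_fun do rewrite -scalerBl.
have etas (V : normedModType R) (g : M -> V) v :
    net_sum X o (fun x => w' x *: g x) v ->
    net_sum X o (fun x => (eta * w' x) *: g x) (eta *: v).
  by move=> gv; have := net_sumZ eta gv; under eq_fun do rewrite scalerA.
pose N1 := k *: N'; pose D1 := k * D'.
have nN1 := scaled _ _ _ nN'; rewrite -/N1 in nN1.
have nD1 : net_sum X o (fun x => w' x *: (1 : R^o)) (D1 : R^o) by exact: (scaled R^o).
have D10 : 0 < D1 by rewrite mulr_gt0.
have bN : `|N - N1| <= C * (eta * `|N1|).
  rewrite -[X in _ <= C * (X * _)]ger0_norm// -normrZ.
  apply: (net_sum_dominated M_proper le_order le_norm f_ge0 _ (diff _ _ _ _ nN nN1) (etas _ _ _ nN1)).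
  by move=> x; rewrite subr_ge0 w'w ww'.
have one0 (x : M) : (0 : R) <= 1 by [].
have bD : `|D - D1| <= 1 * (eta * D1).
  rewrite -[X in _ <= _ * (X * _)]ger0_norm// -[X in _ <= _ * (_ * X)]ger0_norm ?(ltW D10)// -normrM.
  apply: (net_sum_dominated M_proper (real_line_ordered R) (@real_line_norm R) one0 _ (diff R^o _ _ _ nD nD1) (etas R^o _ _ nD1)).
  by move=> x; rewrite subr_ge0 w'w ww'.
have D1D : D1 <= D.
  have : `|D1| <= 1 * `|D|.
    apply: (net_sum_dominated M_proper (real_line_ordered R) (@real_line_norm R) one0 _ nD1 nD).
    by move=> x; rewrite w'0 w'w.
  by rewrite mul1r !gtr0_norm.
have E1 : D'^-1 *: N' = D1^-1 *: N1.
  by rewrite /D1 /N1 scalerA invfM mulrAC mulVf ?mul1r// gt_eqF.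
rewrite E1; clearbody N1 D1.
rewrite (_ : _ - _ = D^-1 *: (N - N1) + (D^-1 - D1^-1) *: N1); last first.
  by rewrite scalerBr scalerBl addrA subrK.
apply: (le_trans (ler_normD _ _)).
rewrite !normrZ (gtr0_norm (x := D^-1)) ?invr_gt0// (gtr0_norm (x := D1^-1)) ?invr_gt0//.
rewrite -/eta.
have iD : D^-1 <= D1^-1 by rewrite lef_pV2.
have h1 : D^-1 * `|N - N1| <= D1^-1 * (C * (eta * `|N1|)).
  by rewrite ler_pM// invr_ge0 ltW.
have h2 : `|D^-1 - D1^-1| * `|N1| <= eta * D1^-1 * `|N1|.
  rewrite ler_wpM2r//.
  have -> : D^-1 - D1^-1 = (D1 - D) * (D^-1 * D1^-1).
    by rewrite mulrBl mulrCA mulfV ?gt_eqF// mulr1 mulrA mulfV ?gt_eqF// mul1r.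
  rewrite normrM distrC (gtr0_norm (x := D^-1 * D1^-1)) ?mulr_gt0 ?invr_gt0//.
  rewrite mulrA ler_wpM2r ?invr_ge0 ?(ltW D10)// ler_pdivrMr//.
  by apply: (le_trans bD); rewrite mul1r ler_wpM2l.
apply: (le_trans (lerD h1 h2)); rewrite le_eqVlt; apply/orP; left; apply/eqP.
by ring.
Qed.

(** Choose a member [y j] of the dense sequence so close to [z] that both
    [f (y j) - f z] and the bound of [ratio_perturbation] are small; the latter
    is uniform in [n]. *)
Lemma ratio_extends (y : nat -> M) (x0 : M) :
  (forall (z : M) (e : R), 0 < e -> exists j, mdist z (y j) < e) ->
  (0 < mult X x0)%N ->
  (forall j, exists N, exists D, [/\ numerators (y j) N, denominators (y j) D
     & (D n)^-1 *: N n @[n --> \oo] --> f (y j)]) ->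
  forall z N D, numerators z N -> denominators z D ->
    (D n)^-1 *: N n @[n --> \oo] --> f z.
Proof.
move=> dense x0X lim z N D nN nD.
apply/cvgrPdist_lt => eps eps0.
have S0 : 0 < S.
  by apply: lt_le_trans (sS 0%N); exact: le_lt_trans (hs 0%N).
pose kap := eps / 2 / ((C + 1) * (`|f z| + 2)).
have C1 : 0 < C + 1 by rewrite addr_gt0.
have f2 : 0 < `|f z| + 2 by rewrite ltr_wpDl.
have kap0 : 0 < kap by rewrite !divr_gt0// mulr_gt0.
(* below this distance the factor [eta] is at most [kap] *)
pose d0 := ln (1 + kap) / (2 * S).
have d00 : 0 < d0 by apply: divr_gt0; rewrite ?mulr_gt0//; apply: ln_gt0; rewrite ltrDl.
have e40 : 0 < Num.min 1 (eps / 4) by rewrite lt_min ltr01 divr_gt0.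
have /cvgrPdist_lt/(_ _ e40)/nbhs_ballP[d1 /= d10 zd1] := @f_cont z.
have dd : 0 < Num.min d0 d1 by rewrite lt_min d00.
have [j] := dense z _ dd; rewrite lt_min => /andP[zj0 zj1].
have := zd1 (y j); rewrite ballEmdist/= => /(_ zj1); rewrite lt_min => /andP[fz1 fz4].
have [N' [D' [nN' nD' lim']]] := lim j.
have /cvgrPdist_lt/(_ _ e40) := lim'.
apply: filterS => n; rewrite lt_min => /andP[a1 a4].
set a := (D' n)^-1 *: N' n in a1 a4.
have pert := ratio_perturbation x0X (nN n) (nD n) (nN' n) (nD' n).
rewrite -/a in pert.
have na : `|a| <= `|f z| + 2.
  have -> : a = f z - (f z - f (y j)) - (f (y j) - a).
    by rewrite opprB addrCA subrr addr0 opprB addrCA subrr addr0.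
  apply: (le_trans (ler_normB _ _)); rewrite (natrD _ 1 1) addrA.
  apply: lerD; last exact: ltW.
  by apply: (le_trans (ler_normB _ _)); apply: lerD => //; exact: ltW.
have eta_le : expR (2 * S * mdist z (y j)) - 1 <= kap.
  rewrite lerBlDl -[leRHS]lnK ?posrE ?addr_gt0// ler_expR.
  by rewrite mulrC -ler_pdivlMr ?mulr_gt0// ltW.
have eta0 : 0 <= expR (2 * S * mdist z (y j)) - 1.
  by rewrite subr_ge0 -[leLHS]expR0 ler_expR !mulr_ge0 ?mdist_ge0// ltW.
have pert2 : `|(D n)^-1 *: N n - a| <= eps / 2.
  apply: (le_trans pert).
  apply: (@le_trans _ _ ((C + 1) * kap * (`|f z| + 2))).
    by rewrite ler_pM ?mulr_ge0 ?(ltW C1)// ler_wpM2l// ltW.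
  rewrite /kap le_eqVlt; apply/orP; left; apply/eqP.
  by field; rewrite !gt_eqF.
rewrite (_ : f z - _ = (f z - f (y j)) + (f (y j) - a) - ((D n)^-1 *: N n - a)); last first.
  by rewrite [X in X - (_ - a)]addrA subrK opprB addrA subrK.
apply: (le_lt_trans (ler_normB _ _)).
have := ler_normD (f z - f (y j)) (f (y j) - a).
by move=> h1; lra.
Qed.

End Extension.

(** * The limit theorem *)

Section Assembly.
Variables (R : realType) (M : completeMetricType R).
Variables (mu : {measure set (borel M) -> \bar R}) (o : M) (h : R).
Hypothesis h_gt0 : 0 < h.
Hypothesis mu_growth : ball_growth mu o h.
Variable H : completeNormedModType R.

Lemma annular_growth_square (f : M -> H) : annular_growth mu o h f ->
  square_growth mu o h f.
Proof.
move=> [Lam [Lam0 _ sLam fLam]] t ht.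
have a0 : 0 < 2 * (t - h) by rewrite mulr_gt0 ?subr_gt0.
have [B B0 LB] := subexp_nat_bounded sLam a0.
exists B => // k; apply: (le_trans (fLam k)); rewrite lee_fin.
apply: le_trans (ler_wpM2r (expR_ge0 _) (LB k)) _.
rewrite -[leLHS]mulrA ler_wpM2l// -expRD le_eqVlt; apply/orP; left; apply/eqP.
by congr expR; ring.
Qed.

Lemma one_square_growth : square_growth mu o h (fun=> 1 : R^o).
Proof.
move=> t ht; have [c c0 mc] := mu_growth ht.
exists (c * expR t) => [|k]; first by rewrite mulr_ge0 ?expR_ge0.
have mA := measurable_annulus o k.
rewrite (_ : (fun x => _) = cst 1%:E); last first.
  by apply/funext => x; rewrite normr1 expr1n.
rewrite integral_cst// mul1e.
apply: (@le_trans _ _ (mu (ball o k.+1%:R))).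
  apply: le_measure; [by apply: mem_set|by apply: mem_set; exact: borel_ball|].
  exact: annulus_ball.
apply: (le_trans (mc k.+1)); rewrite lee_fin -mulrA ler_wpM2l// -expRD ler_expR.
have : 0 <= t * k%:R by rewrite mulr_ge0// ltW// (lt_trans h_gt0).
by rewrite -natr1; nra.
Qed.

Lemma one_mean (z : M) (r : R) (e : R^o) : 0 < r ->
  \int[mu]_(x in ball z r) ((1 : R) * e) = (1 * e : R) * fine (mu (ball z r)).
Proof. by move=> r0; rewrite Rintegral_cst//; exact: borel_ball. Qed.

Lemma variance_ratioE (f : M -> H) (s : R) : h < s -> 0 < mass mu s o ->
  variance_ratio mu o f s = ((mass mu s o ^- 2)%:E * weighted_energy mu f s o)%E.
Proof.
move=> hs m0; rewrite /variance_ratio (massE h_gt0 mu_growth)// -EFin_expe inver.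
by rewrite expf_eq0/= gt_eqF// muleC.
Qed.

Lemma mass_positive (c : R) (N : nat) (s : R) (z : M) : 0 < c ->
  (forall k : nat, (N <= k)%N -> ((c * expR (h * k%:R))%:E <= mu (ball o k%:R))%E) ->
  h < s -> 0 < mass mu s z.
Proof.
move=> c0 low hs; apply: (mass_gt0 h_gt0 mu_growth (r := N%:R + mdist o z)) => //.
apply: (@lt_le_trans _ _ (mu (ball o N%:R))).
  apply: lt_le_trans (low N (leqnn N)).
  by rewrite lte_fin mulr_gt0// expR_gt0.
apply: le_measure; [by apply: mem_set; exact: borel_ball..|].
move=> x; rewrite !ballEmdist/= => ox.
by apply: le_lt_trans (metric_triangle z o x) _; rewrite addrC (metric_sym z) ltrD2r.
Qed.

End Assembly.

Theorem theorem4p14 (R : realType) (M : completeMetricType R)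
    (mu : {measure set (borel M) -> \bar R}) (o : M) (h : R)
    (H : completeNormedModType R) (dot : {dot H for idfun}) (le : rel H)
    (Pi : probability (Conf M) R) (f : M -> H) (s : nat -> R)
    (M_proper : proper_metric M) (mu_radon : radon mu)
    (h_gt0 : 0 < h) (mu_growth : volume_growth mu o h)
    (H_hilbert : norm_of_dot dot)
    (le_order : partially_ordered_space le) (le_norm : norm_compatible le)
    (Pi_small : small_variance Pi) (Pi_intensity : first_intensity Pi mu)
    (f_CMVP : CMVP mu o h le f)
    (s_gt : forall n, (1 <= n)%N -> h < s n) (s_cvg : s n @[n --> \oo] --> h)
    (s_sum : (\sum_(1 <= n <oo) variance_ratio mu o f (s n) < +oo)%E) :
  {ae Pi, forall X : Conf M,
    (forall (t : R) (z : M), h < t ->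
       exists v : H, unconditional_sum X (fun x => weight t z x *: f x) v) /\
    (forall z : M, exists (N : nat -> H) (D : nat -> R),
       [/\ forall n, (1 <= n)%N ->
             unconditional_sum X (fun x => weight (s n) z x *: f x) (N n),
           forall n, (1 <= n)%N ->
             unconditional_sum X (fun x => weight (s n) z x : R^o) (D n) /\
             D n != 0
         & (D n)^-1 *: N n @[n --> \oo] --> f z])}.
Proof.
have [Cn Cn0 leN] := le_norm.
have growth := volume_growth_upper mu_growth.
have [c c0 [k0 low]] := volume_growth_lower mu_growth.
have [C C0 PiC] := scalar_variance Pi_intensity Pi_small.
have ipP := dot_inner_product H_hilbert.
have [[_ f_mv f_growth _] f_cont f_ge0] := f_CMVP.
have mu_ball := ball_finite growth.
have f_mean z r e (r0 : 0 < r) :=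
  mean_value_ip mu_ball ipP f_cont M_proper z e f_mv r0.
pose f1 : M -> R^o := fun=> 1.
have f1_cont : continuous f1 by move=> x; exact: cvg_cst.
have f1_ge0 (x : M) : (0 : R) <= f1 x by exact: ler01.
have ip1P := mulr_inner_product R.
have f1_mean := one_mean mu (M := M).
pose s' n := s n.+1.
have hs n : h < s' n by exact: s_gt.
have [S sS] : exists S, forall n, s' n <= S.
  have [B [_ HB]] : bounded_fun s.
    by apply: (@cvg_seq_bounded R R^o); apply/cvg_ex; exists h.
  exists (`|B| + 1) => n; apply: (le_trans (ler_norm _)); apply: HB => //.
  by rewrite (le_lt_trans (ler_norm _))// ltrDl.
have mass0 n z : 0 < mass mu (s' n) z by exact: (mass_positive h_gt0 growth z c0 low).
have sum_o : summable_at mu f s' o.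
  move: s_sum; rewrite -nneseries_addn; last first.
    move=> n; rewrite /variance_ratio mule_ge0//.
      by apply: integral_ge0 => x _; rewrite lee_fin mulr_ge0 ?weight_ge0 ?sqr_ge0.
    by rewrite inve_ge0 expe_ge0//; apply: integral_ge0 => x _; rewrite lee_fin weight_ge0.
  apply: le_lt_trans; rewrite le_eqVlt; apply/orP; left; apply/eqP.
  apply: eq_eseriesr => n _; rewrite addn1.
  by rewrite -(variance_ratioE h_gt0 growth f (hs n) (mass0 n o)).
have sum_f z : summable_at mu f s' z.
  exact: (summable_at_shift h_gt0 growth f_cont hs sS (fun n => mass0 n z)
    (fun n => mass0 n o) sum_o).
have [y dense] := proper_separable M_proper.
have tame_f := tame_ae M_proper growth Pi_intensity C0 PiC ipP f_cont f_mean
  (annular_growth_square f_growth).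
have tame_1 := tame_ae M_proper growth Pi_intensity C0 PiC ip1P f1_cont f1_mean
  (one_square_growth h_gt0 growth).
have nonempty := nonempty_ae M_proper h_gt0 growth Pi_intensity C0 PiC c0 low.
have num X z : tame X o f h -> exists N, numerators X o f s' z N.
  move=> Xf; have [N nN] := choice (fun n =>
    tame_net_sum M_proper le_order Cn0 leN f_ge0 (ltW h_gt0) z Xf (hs n)).
  by exists N.
have den X z : tame X o f1 h -> exists D, denominators X o s' z D.
  move=> X1; have [D nD] := choice (fun n =>
    tame_net_sum M_proper (real_line_ordered R) ltr01 (@real_line_norm R) f1_ge0
      (ltW h_gt0) z X1 (hs n)).
  by exists D.
have limits : {ae Pi, forall X : Conf M, tame X o f h -> tame X o f1 h ->
    forall j, exists N, exists D, [/\ numerators X o f s' (y j) N,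
      denominators X o s' (y j) D & (D n)^-1 *: N n @[n --> \oo] --> f (y j)]}.
  have [f0|/existsNP[z0 fz0]] := pselect (forall z, f z = 0).
    apply: aeW => X Xf X1 j.
    have [N nN] := num X (y j) Xf; have [D nD] := den X (y j) X1.
    exists N, D; split=> //; rewrite f0.
    (* all partial sums vanish *)
    have N0 n : N n = 0.
      apply/eqP; rewrite -normr_le0; apply/ler_addgt0Pl => e e0; rewrite addr0.
      have [K /(_ (pts X (ball o K%:R)))] := nN n e e0.
      have cb := proper_ball_precompact o K%:R M_proper.
      move=> /(_ (subpts_pts _ cb) (covers_pts X cb (@subset_refl _ _))).
      by rewrite big1 ?sub0r ?normrN// => x _; rewrite f0 scaler0.
    by under eq_fun do rewrite N0 scaler0; exact: cvg_cst.
  have sum_1 z : summable_at mu f1 s' z.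
    apply: (summable_at_shift h_gt0 growth f1_cont hs sS (fun n => mass0 n z)
      (fun n => mass0 n z0)).
    have nf : 0 < `|f z0| ^+ 2 by rewrite exprn_gt0// normr_gt0; exact/eqP.
    apply: (@le_lt_trans _ _ ((`|f z0| ^- 2)%:E * \sum_(0 <= n <oo)
        ((mass mu (s' n) z0 ^- 2)%:E * weighted_energy mu f (s' n) z0))%E); last first.
      apply: lte_mul_pinfty; [|by []|exact: sum_f].
      by rewrite lee_fin invr_ge0 exprn_ge0.
    have m2 n : (0 <= (mass mu (s' n) z0 ^- 2)%:E)%E.
      by rewrite lee_fin invr_ge0 sqr_ge0.
    rewrite -nneseriesZl; last by move=> n _; rewrite mule_ge0 ?weighted_energy_ge0.
    apply: lee_nneseries => [n _ _|n _].
      by rewrite mule_ge0 ?weighted_energy_ge0.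
    rewrite muleCA; apply: lee_wpmul2l => //.
    have := weighted_energy_lower M_proper h_gt0 growth ipP f_cont f_mean z0 (hs n).
    by rewrite -lee_pdivlMl// => /le_trans; apply.
  have ratio_f j := ratio_limit_ae M_proper h_gt0 growth Pi_intensity C0 PiC ipP
    f_cont f_mean hs (fun n => mass0 n (y j)) (sum_f (y j)).
  have ratio_1 j := ratio_limit_ae M_proper h_gt0 growth Pi_intensity C0 PiC ip1P
    f1_cont f1_mean hs (fun n => mass0 n (y j)) (sum_1 (y j)).
  apply: filterS2 (ae_foralln ratio_f) (ae_foralln ratio_1) => X Xf_lim X1_lim Xf X1 j.
  have [N nN] := num X (y j) Xf; have [D nD] := den X (y j) X1.
  exists N, D; split=> //.
  have cN := Xf_lim j N nN; have cD := X1_lim j D nD.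
  rewrite -[f (y j)]scale1r -[1]invr1.
  have -> : (fun n => (D n)^-1 *: N n) = (fun n =>
      ((mass mu (s' n) (y j))^-1 * D n)^-1 *: ((mass mu (s' n) (y j))^-1 *: N n)).
    apply/funext => n; rewrite scalerA invfM invrK mulrAC mulfV ?mul1r//.
    by rewrite gt_eqF.
  by apply: cvgZ => //; apply: cvgV => //; rewrite oner_eq0.
apply: filterS2 (filterI tame_f tame_1) (filterI nonempty limits).
move=> X [Xf X1] [[x0 x0X] Xlim]; split=> [t z ht|z].
  have [v nv] := tame_net_sum M_proper le_order Cn0 leN f_ge0 (ltW h_gt0) z Xf ht.
  by exists v; exact: (net_sum_unconditional M_proper nv).
have [N nN] := num X z Xf; have [D nD] := den X z X1.
(* [N] and [D] are indexed from 0 for the exponents [s 1], [s 2], and so on *)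
exists (fun n => N n.-1), (fun n => D n.-1); split=> [[//|n] _|[//|n] _|].
- exact: (net_sum_unconditional M_proper (nN n)).
- split.
    have := net_sum_unconditional M_proper (nD n).
    by under eq_fun do rewrite /= [_ *: _]mulr1.
  by rewrite gt_eqF//; exact: (denominator_gt0 M_proper x0X (nD n)).
rewrite -cvg_shiftS /=.
exact: (ratio_extends M_proper (ltW h_gt0) le_order Cn0 leN f_cont f_ge0 hs sS
  dense x0X (Xlim Xf X1) nN nD).
Qed.
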